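(* Assume the following hypothesis holds: for every integer $d'\geq 3$ there exists $\gamma_{d'}>0$ such that every primitive distance-regular graph $Y$ of diameter $d'$ on $N$ vertices satisfies $\mathrm{motion}(Y)\geq \gamma_{d'}N$ unless $Y$ is the Hamming graph $H(d',s)$ or the Johnson graph $J(s,d')$ for some $s$. Then for every $d\geq 3$ there exists $\widetilde\gamma_d>0$ such that every distance-regular graph $X$ of diameter $d$ on $n$ vertices satisfies $\mathrm{motion}(X)\geq\widetilde\gamma_d n$, or $X$ is a Johnson graph $J(s,d)$, or a Hamming graph $H(d,s)$, or a cocktail-party graph.
   Context: A distance-regular graph of diameter $d$ is a connected graph such that, for $v,w$ at distance $i$, the numbers of neighbours of $w$ at distance $i-1,i,i+1$ from $v$ are constants $c_i,a_i,b_i$. It is primitive if for each $1\le i\le d$ the graph on the same vertices with $u\sim v$ iff $\mathrm{dist}(u,v)=i$ is connected. The motion of a graph is the minimum number of vertices moved by a non-identity automorphism. The Johnson graph $J(m,d)$ ($m\ge 2d+1$) has the $d$-subsets of an $m$-set as vertices, adjacent iff they share $d-1$ elements. The Hamming graph $H(d,m)$ has the $d$-tuples over an $m$-set as vertices, adjacent iff they differ in exactly one coordinate. A cocktail-party graph is a regular complete bipartite graph with one perfect matching removed. *)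

(* Defs.v *)
From HB Require Import structures.
From mathcomp Require Import all_boot all_order all_algebra all_fingroup.
Set Implicit Arguments. Unset Strict Implicit. Unset Printing Implicit Defensive.
Import Order.TTheory GRing.Theory Num.Theory.

Section Graphs.
Variable T : finType.
Implicit Types (e : rel T) (x y : T).

Definition simple_graph e := symmetric e /\ irreflexive e.

Fixpoint ball e x (k : nat) : {set T} :=
  if k is k'.+1 then ball e x k' :|: [set y | [exists z in ball e x k', e z y]]
  else [set x].

(* Graph distance: the number of k < #|T| such that y is not within k
   steps of x. For a connected graph this is the usual distance
   (always <= #|T| - 1); for unreachable y it equals #|T|. *)
Definition gdist e x y : nat := \sum_(k < #|T|) (y \notin ball e x k).

Definition gconnected e := forall x y, connect e x y.

Definition has_diameter e (d : nat) :=
  (forall x y, gdist e x y <= d) /\ exists x y, gdist e x y = d.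

Definition distance_regular e (d : nat) :=
  [/\ simple_graph e, gconnected e, has_diameter e d &
   exists c a b : nat -> nat, forall v w,
     let i := gdist e v w in
     [/\ #|[set u | e w u & gdist e v u == i.-1]| = c i,
         #|[set u | e w u & gdist e v u == i]| = a i &
         #|[set u | e w u & gdist e v u == i.+1]| = b i]].

Definition dist_graph e (i : nat) : rel T := fun u v => gdist e u v == i.

Definition primitive_drg e (d : nat) :=
  distance_regular e d /\
  forall i, 1 <= i <= d -> gconnected (dist_graph e i).

Definition graph_aut e (s : {perm T}) := forall x y, e (s x) (s y) = e x y.

(* motion(X) >= r : every non-identity automorphism moves at least r
   vertices (motion of a graph with trivial automorphism group is +oo). *)
Definition motion_at_least e (r : rat) :=
  forall s : {perm T}, graph_aut e s -> s != 1%g ->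
    (r <= (#|[set x | s x != x]|%:R : rat))%R.

End Graphs.

Definition graph_iso (T U : finType) (e : rel T) (f : rel U) :=
  exists g : T -> U, bijective g /\ forall x y, f (g x) (g y) = e x y.

Definition johnson_vertex (m d : nat) := {A : {set 'I_m} | #|A| == d}.
Definition johnson_rel (m d : nat) : rel (johnson_vertex m d) :=
  fun A B => #|val A :&: val B| == d.-1.
(* The Johnson graph J(m,d) is only considered for m >= 2d+1 (as in the paper). *)
Definition is_johnson (T : finType) (e : rel T) (m d : nat) :=
  2 * d + 1 <= m /\ graph_iso e (@johnson_rel m d).

Definition hamming_rel (d m : nat) : rel {ffun 'I_d -> 'I_m} :=
  fun f g => #|[set i | f i != g i]| == 1.
Definition is_hamming (T : finType) (e : rel T) (d m : nat) :=
  graph_iso e (@hamming_rel d m).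

(* Cocktail-party graph, as defined in the paper: the regular complete
   bipartite graph K_{m,m} with one perfect matching removed. *)
Definition cocktail_rel (m : nat) : rel (bool * 'I_m) :=
  fun u v => (u.1 != v.1) && (u.2 != v.2).
Definition is_cocktail_party (T : finType) (e : rel T) :=
  exists m, graph_iso e (@cocktail_rel m).

(* Main.v *)
(* Let s be a nontrivial automorphism moving few of the n vertices. Two vertices
   u and s u have equal distances to every fixed vertex, so the set D(u, s u) of
   vertices at different distances from u and s u is small. The size of D(x, y)
   depends only on dist x y and is subadditive, so it is small for all pairs
   joined by steps of length dist u (s u). By Smith's theorem a graph of valency
   at least 3 that is not primitive is bipartite or antipodal.

   Counting then shows that almost all vertices (of each half, if the graph is
   bipartite) lie in one sphere around any given vertex. A moved vertex u has few
   fixed neighbours, as these are common neighbours of u and s u. If they are a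
   fraction of the valency bounded away from 1 at each step, geodesics from u
   stay among the moved vertices and reach a positive proportion of the big
   sphere, a contradiction. In the bipartite case this always works, possibly in
   the distance-3 graph, except for cocktail-party graphs.

   An antipodal graph of diameter d >= 6 that is not bipartite folds to a
   primitive graph of diameter d./2 >= 3, to which the hypothesis applies; the
   Hamming and Johnson graphs have no such covers because the descents towards a
   vertex would lift to a single sheet. For d = 3 each fixed vertex has exactly
   one neighbour in a moved fibre. For d = 4 and d = 5 the walk fails only if
   adjacent vertices have more than 2k/5 common neighbours while c_2 is tiny.
   Then every neighbourhood is a union of two cliques, the graph is the
   collinearity graph of a geometry with two lines on each point, and a line at
   distance 2 from a point contradicts antipodality. *)
Require Import Defs.
From mathcomp Require Import all_boot all_order all_algebra all_fingroup.
From mathcomp Require Import zify.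
Import Order.TTheory GRing.Theory Num.Theory.

Set Implicit Arguments.
Unset Strict Implicit.
Unset Printing Implicit Defensive.

(** * Graph distance *)

(** The case division is shaped by the hypothesis speaking only of diameter at least 3. It is
    applied to the graph itself and to the folded graph, whose diameter is [d./2]; so antipodal
    graphs with [d <= 5] need a direct argument, and bipartite graphs, whose halved graphs also have
    diameter [d./2], get one for every [d].

    An automorphism that fixes some vertex has displacement 1 or 2 somewhere. This selects a
    distance graph to which Smith's theorem applies, and the bound on distinguishing sets then
    spreads at the cost of a factor at most [d.+1].

    Valency at most 2 is split off because polygons escape Smith's theorem: the distance-3 graph of
    a 9-gon is a union of triangles. There the order is bounded in terms of [d]. The other constants
    are crude: a factor 10 is lost per step of a walk, while 40 and 1000 are margins by which a
    large layer exceeds all small ones. *)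

Section Distance.
Variables (T : finType) (e : rel T).
Hypotheses (es : symmetric e) (ei : irreflexive e) (ec : gconnected e).
Notation dist := (gdist e).
Implicit Types x y z w : T.

Lemma ball_mono x i j : i <= j -> ball e x i \subset ball e x j.
Proof.
move=> /subnK <-; elim: (j - i) => [|m IH] //=.
exact: subset_trans IH (subsetUl _ _).
Qed.

Lemma ballS_edge x y z k : y \in ball e x k -> e y z -> z \in ball e x k.+1.
Proof.
by move=> yk yz /=; rewrite !inE; apply/orP; right; apply/existsP; exists y; rewrite yk.
Qed.

Lemma ball_full x y : y \in ball e x #|T|.-1.
Proof.
case/connectP: (ec x y) => p; case/shortenP => q eq uq _ ->.
have sq : size q <= #|T|.-1.
  have := max_card (mem (x :: q)); rewrite (card_uniqP uq) /=; lia.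
apply: (subsetP (ball_mono x sq)).
elim/last_ind: q {sq} eq {uq} => [|q z IH] /=; first by rewrite inE.
rewrite rcons_path last_rcons size_rcons => /andP[/IH h ez].
exact: ballS_edge h ez.
Qed.

Lemma sum_ltn_ord N k : \sum_(i < N) (i < k) = minn N k.
Proof.
elim: N => [|N IH]; first by rewrite big_ord0 min0n.
rewrite big_ord_recr /= IH; lia.
Qed.

(** Balls are nested, so the radii below [#|T|] that miss [y] form an initial segment, whose length
    is the first radius reaching [y]; by [ball_full] there is one. *)
Lemma ballE x y k : (y \in ball e x k) = (dist x y <= k).
Proof.
apply/idP/idP => [yk|].
  apply: leq_trans (geq_minr #|T| k); rewrite -sum_ltn_ord; apply: leq_sum => i _.
  case: ltnP => // ki; case: (boolP (y \in _)) => // /negP[].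
  exact: (subsetP (ball_mono x ki)).
apply: contraTT => yk; rewrite -ltnNge.
have kN : k < #|T|.
  rewrite ltnNge; apply: contra yk => Nk.
  by apply: (subsetP (ball_mono x _)) (ball_full x y); lia.
suff: minn #|T| k.+1 <= dist x y by lia.
rewrite -sum_ltn_ord; apply: leq_sum => i _; case: ltnP => // ik.
case: (boolP (y \in _)) => // yi; case/negP: yk.
exact: (subsetP (ball_mono x (ltnSE ik))).
Qed.

Lemma dist_eq0 x y : (dist x y == 0) = (x == y).
Proof. by rewrite -leqn0 -ballE /= inE eq_sym. Qed.

Lemma distxx x : dist x x = 0.
Proof. by apply/eqP; rewrite dist_eq0. Qed.

Lemma dist_edge x y z : e y z -> dist x z <= (dist x y).+1.
Proof. by move=> yz; rewrite -ballE; apply: ballS_edge yz; rewrite ballE. Qed.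

Lemma dist_pred x y k : dist x y = k.+1 -> exists2 z, dist x z = k & e z y.
Proof.
move=> dk; have : y \in ball e x k.+1 by rewrite ballE dk.
rewrite /= inE ballE dk ltnn inE /= => /existsP[z /andP[]].
rewrite ballE => zk zy; exists z => //.
by have := dist_edge x zy; lia.
Qed.

Lemma dist_edgel x z y : e x z -> dist x y <= (dist z y).+1.
Proof.
move=> xz; have [k dk] : exists k, dist z y = k by exists (dist z y).
elim: k y dk => [|k IH] y.
  by move/eqP; rewrite dist_eq0 => /eqP <-; have := dist_edge x xz; rewrite !distxx.
by move=> dk; case/dist_pred: (dk) => y' dk'; have le := IH _ dk'; move=> y'y; have := dist_edge x y'y; lia.
Qed.

Lemma distC x y : dist x y = dist y x.
Proof.
suff le u v : dist u v <= dist v u by apply/eqP; rewrite eqn_leq !le.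
have [k dk] : exists k, dist v u = k by exists (dist v u).
elim: k u dk => [|k IH] u.
  by move/eqP; rewrite dist_eq0 => /eqP->; rewrite distxx.
move=> dk; case/dist_pred: (dk) => w dk'; have le := IH _ dk'; rewrite es => uw.
by have := dist_edgel v uw; lia.
Qed.

Lemma dist_tri x y z : dist x z <= dist x y + dist y z.
Proof.
have [k dk] : exists k, dist y z = k by exists (dist y z).
elim: k z dk => [|k IH] z.
  by move/eqP; rewrite dist_eq0 => /eqP->; rewrite distxx addn0.
by move=> dk; case/dist_pred: (dk) => w dk'; have le := IH _ dk'; move=> wz; have := dist_edge x wz; lia.
Qed.

Lemma dist_eq1 x y : (dist x y == 1) = e x y.
Proof.
apply/eqP/idP => [/dist_pred[z /eqP]|xy]; first by rewrite dist_eq0 => /eqP->.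
have := dist_edge x xy; rewrite distxx => le1.
have : dist x y != 0 by rewrite dist_eq0; apply: contraTneq xy => ->; rewrite ei.
lia.
Qed.

Lemma dist1 x y : e x y -> dist x y = 1.
Proof. by rewrite -dist_eq1 => /eqP. Qed.

Lemma dist_split x y i : i <= dist x y ->
  exists2 z, dist x z = i & dist z y = dist x y - i.
Proof.
move=> le; have [m dm] : exists m, dist x y = i + m by exists (dist x y - i); lia.
elim: m y dm le => [|m IH] y dm le.
  by exists y; rewrite ?distxx ?dm; lia.
rewrite addnS in dm; case/dist_pred: (dm) => y' d' y'y.
case: (IH y' d'); first lia.
move=> z dz1 dz2; exists z => //.
have := dist_edge z y'y; have := dist_tri x z y; lia.
Qed.

Lemma dist_adj w u v : e u v -> dist w u <= (dist w v).+1 /\ dist w v <= (dist w u).+1.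
Proof. by move=> uv; split; [rewrite es in uv|]; exact: dist_edge. Qed.

Lemma aut_dist (s : {perm T}) x y : graph_aut e s -> dist (s x) (s y) = dist x y.
Proof.
move=> sA; suff h k u v : (s v \in ball e (s u) k) = (v \in ball e u k).
  by apply/eqP; rewrite eqn_leq -!ballE h ballE -h ballE !leqnn.
elim: k v => [|k IH] v /=; first by rewrite !inE (inj_eq perm_inj).
rewrite !inE IH; congr (_ || _); apply/existsP/existsP => [[z]|[z]].
  by rewrite -(permKV s z) IH sA => h; exists (s^-1 z)%g.
by move=> h; exists (s z); rewrite IH sA.
Qed.

End Distance.

(** * Intersection numbers *)

Section Counting.
Variables (T : finType).

Lemma card_sumb (P : pred T) : #|[set u | P u]| = \sum_u (P u : nat).
Proof.
by rewrite cardsE -sum1_card [RHS](eq_bigr (fun u => if P u then 1 else 0)) -?big_mkcond //= => u _; case: (P u).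
Qed.

End Counting.

Section DistanceInvariant.
Variables (T : finType) (e : rel T).
Notation dist := (gdist e).

(** Turns an [F] that depends only on the distance into a function of that distance by evaluating it
    at an arbitrary pair. *)
Definition dval (F : T -> T -> nat) (h : nat) : nat :=
  if [pick p : T * T | dist p.1 p.2 == h] is Some p then F p.1 p.2 else 0.

Definition dinv (F : T -> T -> nat) :=
  forall x y x' y', dist x y = dist x' y' -> F x y = F x' y'.

Lemma dvalE F x y : dinv F -> F x y = dval F (dist x y).
Proof.
move=> Fi; rewrite /dval; case: pickP => [[x' y'] /= /eqP h|/(_ (x, y))]; last by rewrite eqxx.
exact: Fi.
Qed.

Definition nbrs (j : nat) (v w : T) := #|[set u | e w u & dist v u == j]|.
(* In the usual notation nb i i.-1, nb i i, nb i i.+1 are c_i, a_i, b_i (so nb 0 1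
   is the valency), pn i j h is p^h_{ij} and ksph i is k_i; all are 0 on a value
   that is not a distance. *)
Definition nb i j := dval (nbrs j) i.
Definition pnum (i j : nat) (x y : T) := #|[set w | (dist x w == i) && (dist y w == j)]|.
Definition pn i j h := dval (pnum i j) h.
Definition ksph i := pn i i 0.

End DistanceInvariant.

Section DRG.
Variables (T : finType) (e : rel T) (d : nat).
Hypothesis drg : distance_regular e d.
Notation dist := (gdist e).
Notation nb := (nb e).
Notation pn := (pn e).
Notation k_ := (ksph e).
Implicit Types x y z u v w : T.

Lemma drg_sym : symmetric e. Proof. by case: drg => [[]]. Qed.
Lemma drg_irr : irreflexive e. Proof. by case: drg => [[]]. Qed.
Lemma drg_conn : gconnected e. Proof. by case: drg. Qed.
Local Notation es := drg_sym.
Local Notation ei := drg_irr.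
Local Notation ec := drg_conn.

Lemma le_diam x y : dist x y <= d. Proof. by case: drg => _ _ []. Qed.

(** Distance-regularity supplies the counts for [j] within 1 of the distance; for any other [j] the
    count is 0 by the triangle inequality, so [j] may be arbitrary. *)
Lemma nbE j v w : #|[set u | e w u & dist v u == j]| = nb (dist v w) j.
Proof.
apply: (@dvalE _ _ (nbrs e j)) => {v w} x y x' y' dE; rewrite /nbrs.
case: drg => _ _ _ [c [a [b cab]]].
have [c1 a1 b1] := cab x y; have [c2 a2 b2] := cab x' y'.
have far u v j' : (j'.+1 < dist u v) || ((dist u v).+1 < j') ->
    #|[set w | e v w & dist u w == j']| = 0.
  move=> h; apply/eqP; rewrite cards_eq0; apply/eqP/setP => w; rewrite !inE.
  by apply/negP => /andP[/(dist_adj es ec u)[h1 h2] /eqP]; lia.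
have [jlt|jlt|->] := ltngtP j (dist x y); last by rewrite a1 dE a2.
- case: (ltnP j.+1 (dist x y)) => jd; first by rewrite (far x y) ?jd // (far x' y') // -dE jd.
  have -> : j = (dist x y).-1 by lia.
  by rewrite c1 dE c2.
- case: (ltnP (dist x y).+1 j) => jd; first by rewrite (far x y) ?jd ?orbT // (far x' y') // -dE jd orbT.
  have -> : j = (dist x y).+1 by lia.
  by rewrite b1 dE b2.
Qed.

Lemma nb_sumE j v w : \sum_(u | e w u) (dist v u == j) = nb (dist v w) j.
Proof.
rewrite -nbE card_sumb big_mkcond /=; apply: eq_bigr => u _.
by case: (e w u).
Qed.

Lemma dist_exists i : i <= d -> exists x y, dist x y = i.
Proof.
case: drg => _ _ [_ [x [y <-]]] _ id.
by case: (dist_split ec id) => z <- _; exists x, z.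
Qed.

Lemma nb_far i j : i <= d -> (j.+1 < i) || (i.+1 < j) -> nb i j = 0.
Proof.
case/dist_exists => x [y <-] h; rewrite -nbE; apply/eqP; rewrite cards_eq0; apply/eqP/setP => w; rewrite !inE.
by apply/negP => /andP[/(dist_adj es ec x)[h1 h2] /eqP]; lia.
Qed.

Lemma c_gt0 i : i < d -> 0 < nb i.+1 i.
Proof.
case/dist_exists => x [y dxy]; rewrite -dxy -nbE.
case: (dist_pred ec dxy) => z dz zy.
by apply/card_gt0P; exists z; rewrite inE es zy dz eqxx.
Qed.

Lemma b_gt0 i : i < d -> 0 < nb i i.+1.
Proof.
case/dist_exists => x [y dxy].
case: (dist_pred ec dxy) => z dz zy; rewrite -dz -nbE.
by apply/card_gt0P; exists y; rewrite inE zy dz dxy eqxx.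
Qed.

Lemma sum_nbrs (g : nat -> nat) v w :
  \sum_(u | e w u) g (dist v u) = \sum_(j < d.+1) g j * nb (dist v w) j.
Proof.
under [RHS]eq_bigr => j _ do rewrite -nb_sumE big_distrr /=.
rewrite exchange_big /=; apply: eq_bigr => u _.
have ud : dist v u < d.+1 by rewrite ltnS le_diam.
rewrite (bigD1 (Ordinal ud)) //= eqxx muln1 big1 ?addn0 // => j /eqP jn.
by case: eqP => [h|]; [case: jn; apply: val_inj|rewrite muln0].
Qed.

Lemma pnum_sumE i j x y :
  pnum e i j x y = \sum_w (dist x w == i) * (dist y w == j).
Proof. by rewrite /pnum card_sumb; apply: eq_bigr => w _; rewrite mulnb. Qed.

(** Both sides count pairs of a neighbour [u] of [y] and a vertex [w] with [dist x w = i] and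
    [dist u w = j]; on the right they are grouped by [dist y w]. *)
Lemma pnum_rec i j x y :
  \sum_(u | e y u) pnum e i j x u = \sum_(h < d.+1) nb h j * pnum e i h x y.
Proof.
under eq_bigr => u _ do rewrite pnum_sumE.
under [RHS]eq_bigr => h _ do rewrite pnum_sumE big_distrr /=.
rewrite exchange_big [RHS]exchange_big /=; apply: eq_bigr => w _.
rewrite -big_distrr /=; under eq_bigr => u _ do rewrite (distC es ec u w).
rewrite nb_sumE (distC es ec w y).
have wd : dist y w < d.+1 by rewrite ltnS le_diam.
rewrite (bigD1 (Ordinal wd)) //= eqxx muln1 big1 ?addn0 1?mulnC // => j' /eqP jn.
by case: (dist y w =P j') => [h|]; [case: jn; apply: val_inj|rewrite !muln0].
Qed.

(* The recurrence expresses the (j+1)-st count through the counts up to j,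
   because the coefficient c_{j+1} does not vanish. *)
Lemma pnum_dinv i j : dinv e (pnum e i j).
Proof.
have [m] := ubnP j; elim: m j => // m IH [_ x y x' y' dE|j jm x y x' y' dE].
  have p0 u v : pnum e i 0 u v = (dist u v == i).
    rewrite pnum_sumE (bigD1 v) //= (distxx ec) eqxx muln1 big1 ?addn0 // => w wv.
    by rewrite (dist_eq0 ec) (eq_sym v) (negbTE wv) muln0.
  by rewrite !p0 dE.
have [jd|jd] := ltnP j d; last first.
  have p0 u v : pnum e i j.+1 u v = 0.
    rewrite pnum_sumE big1 // => w _; case: eqP; case: eqP => //= h.
    by have := le_diam v w; lia.
  by rewrite !p0.
have IHj : dinv e (pnum e i j) by apply: IH; lia.
have S : \sum_(h < d.+1) nb h j * pnum e i h x y = \sum_(h < d.+1) nb h j * pnum e i h x' y'.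
  rewrite -!pnum_rec.
  under eq_bigr => u _ do rewrite (dvalE _ _ IHj).
  under [RHS]eq_bigr => u _ do rewrite (dvalE _ _ IHj).
  by rewrite !sum_nbrs dE.
have jd1 : j.+1 < d.+1 by [].
move: S; rewrite (bigD1 (Ordinal jd1)) //= [RHS](bigD1 (Ordinal jd1)) //=.
rewrite (eq_bigr (fun h : 'I_d.+1 => nb h j * pnum e i h x' y')) => [/eqP|h hj].
  by rewrite eqn_add2r eqn_pmul2l ?c_gt0 // => /eqP.
case: (ltngtP h j.+1) => hj'; last by case/eqP: hj; apply: val_inj.
  by congr (_ * _); apply: IH => //; lia.
by rewrite nb_far ?mul0n //; have := ltn_ord h; lia.
Qed.

Lemma pnE i j x y : #|[set w | (dist x w == i) && (dist y w == j)]| = pn i j (dist x y).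
Proof. exact: (dvalE _ _ (@pnum_dinv i j)). Qed.

Lemma ksphE i x : #|[set w | dist x w == i]| = k_ i.
Proof.
by rewrite /ksph -[0](distxx ec x) -pnE; apply: eq_card => w; rewrite !inE andbb.
Qed.

End DRG.

(** * Distinguishing sets and inequalities between intersection numbers *)

Definition Dset (T : finType) (e : rel T) (x y : T) := [set w | gdist e x w != gdist e y w].
Definition moved (T : finType) (s : {perm T}) := [set x | s x != x].
Lemma moved_gt0 (T : finType) (s : {perm T}) : s != 1%g -> 0 < #|moved s|.
Proof.
move=> s1; rewrite card_gt0; apply: contra s1 => /eqP h; apply/eqP/permP => x; rewrite perm1.
by have : x \notin moved s; [rewrite h inE|rewrite inE negbK => /eqP].
Qed.

Definition parity_graph (T : finType) (e : rel T) :=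
  forall w x y, e x y -> odd (gdist e w y) = ~~ odd (gdist e w x).

Section DRGFacts.
Variables (T : finType) (e : rel T) (d : nat).
Hypothesis drg : distance_regular e d.
Notation dist := (gdist e).
Notation nb := (nb e).
Notation pn := (pn e).
Notation k_ := (ksph e).
Notation D := (Dset e).
Implicit Types x y z u v w : T.
Local Notation es := (drg_sym drg).
Local Notation ei := (drg_irr drg).
Local Notation ec := (drg_conn drg).
Local Notation dC := (distC es ec).

Lemma valencyE w : #|[set u | e w u]| = nb 0 1.
Proof.
have -> : nb 0 1 = nb (dist w w) 1 by rewrite (distxx ec).
rewrite -(nbE drg); apply: eq_card => u; rewrite !inE.
by rewrite (dist_eq1 ei ec) andbb.
Qed.

Lemma common_nbrsE x y : #|[set u | e x u & e y u]| = nb (dist x y) 1.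
Proof.
rewrite -(nbE drg); apply: eq_card => u; rewrite !inE.
by rewrite (dist_eq1 ei ec) andbC.
Qed.

Lemma sphere_nonempty x i : i <= d -> exists y, dist x y = i.
Proof.
move=> /(dist_exists drg)[u [v duv]].
have /card_gt0P[y] : 0 < #|[set w | dist x w == i]|.
  rewrite (ksphE drg) -(ksphE drg i u); apply/card_gt0P.
  by exists v; rewrite inE duv.
by rewrite inE => /eqP; exists y.
Qed.

Lemma ksph_gt0 i : i <= d -> 0 < k_ i.
Proof.
move=> id; have [x _] := dist_exists drg id; have [y dy] := sphere_nonempty x id.
by rewrite -(ksphE drg i x); apply/card_gt0P; exists y; rewrite inE dy.
Qed.

Lemma ksph0 : k_ 0 = 1.
Proof.
have [x _] := dist_exists drg (leq0n d).
rewrite -(ksphE drg 0 x) -(cards1 x); apply: eq_card => y.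
by rewrite !inE (dist_eq0 ec) eq_sym.
Qed.

Lemma ksph1 : k_ 1 = nb 0 1.
Proof.
have [x _] := dist_exists drg (leq0n d).
rewrite -(ksphE drg 1 x) -(valencyE x); apply: eq_card => y.
by rewrite !inE (dist_eq1 ei ec).
Qed.

Lemma sphere_big i : d < i -> k_ i = 0.
Proof.
move=> di; have [x _] := dist_exists drg (leq0n d).
rewrite -(ksphE drg i x); apply/eqP; rewrite cards_eq0; apply/eqP/setP => y.
by rewrite !inE; apply/negP => /eqP h; have := le_diam drg x y; lia.
Qed.

Lemma sum_by_dist (P : pred T) x :
  #|[set y | P y]| = \sum_(i < d.+1) #|[set y | P y & dist x y == i]|.
Proof.
under [RHS]eq_bigr => i _ do rewrite card_sumb.
rewrite exchange_big card_sumb /=; apply: eq_bigr => y _.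
have yd : dist x y < d.+1 by rewrite ltnS (le_diam drg).
rewrite (bigD1 (Ordinal yd)) //= eqxx andbT big1 ?addn0 // => j /eqP jn.
by case: (dist x y =P j) => [h|]; [case: jn; apply: val_inj|rewrite andbF].
Qed.

Lemma sum_ksph : \sum_(i < d.+1) k_ i = #|T|.
Proof.
have [x _] := dist_exists drg (leq0n d).
rewrite -cardsT (_ : setT = [set y | xpredT y]); last by apply/setP => y; rewrite !inE.
rewrite (sum_by_dist _ x); apply: eq_bigr => i _.
by rewrite -(ksphE drg i x); apply: eq_card => y; rewrite !inE.
Qed.

Lemma layer_edges i j : k_ i * nb i j = k_ j * nb j i.
Proof.
have [x _] := dist_exists drg (leq0n d).
have h i' j' : k_ i' * nb i' j' = \sum_(p : T * T) [&& dist x p.1 == i', dist x p.2 == j' & e p.1 p.2].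
  rewrite -(pair_bigA _ (fun w u => [&& dist x w == i', dist x u == j' & e w u] : nat)) /=.
  rewrite -(ksphE drg i' x) card_sumb big_distrl /=.
  apply: eq_bigr => w _; case: eqP => [dw|_] /=; last by rewrite big1.
  rewrite mul1n -dw -(nbE drg) card_sumb; apply: eq_bigr => u _; by rewrite andbC.
rewrite !h (reindex_inj (h := fun p : T * T => (p.2, p.1))) /=; last by move=> [? ?] [? ?] [-> ->].
by apply: eq_bigr => p _; rewrite es andbCA.
Qed.

Lemma nb_sum i : 0 < i <= d -> nb i i.-1 + nb i i + nb i i.+1 = nb 0 1.
Proof.
case/andP=> i0 /(dist_exists drg)[x [y dxy]].
rewrite -(valencyE y) -dxy -!(nbE drg) !card_sumb -!big_split /=; apply: eq_bigr => u _.
case yu: (e y u) => //=; have [] := dist_adj es ec x yu.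
by do 3!case: eqP => //=; lia.
Qed.

Lemma nb_le_valency i j : i <= d -> nb i j <= nb 0 1.
Proof.
case/(dist_exists drg) => x [y <-]; rewrite -(valencyE y) -(nbE drg).
by apply: subset_leq_card; apply/subsetP => u; rewrite !inE => /andP[].
Qed.

(** With [z] the first step of a geodesic from [x] to [y], the neighbours of [y] that approach [z]
    also approach [x]. *)
Lemma c_monoS i : i.+2 <= d -> nb i.+1 i <= nb i.+2 i.+1.
Proof.
case/(dist_exists drg) => x [y dxy]; case: (@dist_split _ _ ec x y 1); first lia.
move=> z dz dzy; rewrite dxy subn1 /= in dzy.
rewrite -[X in nb X i]dzy -[X in _ <= nb X _]dxy -!(nbE drg); apply: subset_leq_card; apply/subsetP => u.
rewrite !inE => /andP[yu /eqP du]; rewrite yu /=.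
by have := dist_tri ec x z u; have [] := dist_adj es ec x yu; lia.
Qed.

Lemma b_monoS i : i.+1 <= d -> nb i.+1 i.+2 <= nb i i.+1.
Proof.
case/(dist_exists drg) => x [y dxy]; case: (@dist_split _ _ ec x y 1); first lia.
move=> z dz dzy; rewrite dxy subn1 /= in dzy.
rewrite -[X in _ <= nb X _]dzy -[X in nb X _ <= _]dxy -!(nbE drg); apply: subset_leq_card; apply/subsetP => u.
rewrite !inE => /andP[yu /eqP du]; rewrite yu /=.
by have := dist_tri ec x z u; have [] := dist_adj es ec z yu; lia.
Qed.

Lemma c_mono i j : i <= j -> j.+1 <= d -> nb i.+1 i <= nb j.+1 j.
Proof.
move=> /subnK <-; elim: (j - i) => //= m IH md.
by apply: leq_trans (c_monoS _) => //; apply: IH; lia.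
Qed.

Lemma b_mono i j : i <= j -> j <= d -> nb j j.+1 <= nb i i.+1.
Proof.
move=> /subnK <-; elim: (j - i) => //= m IH md.
by apply: leq_trans (b_monoS _) _ => //; apply: IH; lia.
Qed.

(** At a vertex [z] of a geodesic from [x] to [y], the neighbours of [z] that approach [y] move away
    from [x]. *)
Lemma c_le_b i j : i.+1 + j <= d -> nb i.+1 i <= nb j j.+1.
Proof.
case/(dist_exists drg) => x [y dxy]; case: (@dist_split _ _ ec x y j); first lia.
move=> z dz dzy; have dyz : dist y z = i.+1 by rewrite dC; lia.
rewrite -[X in nb X i]dyz -[X in _ <= nb X _]dz -!(nbE drg); apply: subset_leq_card; apply/subsetP => u.
rewrite !inE => /andP[zu /eqP du]; rewrite zu /=.
by have := dist_tri ec x u y; have [] := dist_adj es ec x zu; rewrite [dist u y]dC; lia.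
Qed.

Lemma extend x y : dist x y < d -> exists2 z, e y z & dist x z = (dist x y).+1.
Proof.
move=> /(b_gt0 drg); rewrite -(nbE drg) => /card_gt0P[z].
by rewrite inE => /andP[yz /eqP]; exists z.
Qed.

Lemma extend_to x y j : dist x y <= j <= d ->
  exists2 z, dist x z = j & dist y z = j - dist x y.
Proof.
case/andP=> /subnKC <-; elim: (j - _) => [|m IH] h.
  by exists y; rewrite ?(distxx ec); lia.
case: IH => [|z dz dyz]; first lia.
case: (@extend x z) => [|u zu du]; first lia.
exists u; first lia.
have [] := dist_adj es ec y zu; have := dist_tri ec x y u; lia.
Qed.

Lemma ksphS_le i : i < d -> k_ i.+1 <= k_ i * nb 0 1.
Proof.
move=> id; apply: leq_trans (_ : k_ i.+1 * nb i.+1 i <= _).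
  by rewrite leq_pmulr // (c_gt0 drg).
by rewrite -layer_edges leq_mul2l nb_le_valency ?orbT //; lia.
Qed.

(** Serves for valency at most 2, where it bounds the order by a function of [d]. *)
Lemma card_bound : #|T| <= d.+1 * nb 0 1 ^ d.
Proof.
have k0 : d = 0 \/ 0 < nb 0 1 by case: (posnP d) => h; [left|right; apply: (b_gt0 drg)].
rewrite -sum_ksph -[d.+1 in X in _ <= X]card_ord -sum_nat_const; apply: leq_sum => i _.
have h j : j <= d -> k_ j <= nb 0 1 ^ j.
  elim: j => [|j IH] jd; first by rewrite ksph0.
  apply: leq_trans (ksphS_le jd) _; rewrite expnSr leq_mul2r IH ?orbT //; lia.
case: i => i id /=; apply: leq_trans (h _ (ltnSE id)) _.
case: k0 => [d0|k0]; last by rewrite leq_pexp2l //; lia.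
by have -> : i = d by lia.
Qed.

(** How many vertices stand in a given position to a pair depends only on the distance of the pair,
    so a position occupied for one pair is occupied for the other. *)
Lemma transfer x y x' y' w : dist x y = dist x' y' ->
  exists2 w', dist x' w' = dist x w & dist y' w' = dist y w.
Proof.
move=> dE; have : 0 < #|[set u | (dist x u == dist x w) && (dist y u == dist y w)]|.
  by apply/card_gt0P; exists w; rewrite inE !eqxx.
rewrite (pnE drg) dE -(pnE drg) => /card_gt0P[w'].
by rewrite inE => /andP[/eqP ? /eqP ?]; exists w'.
Qed.

(** The complement of [D u v] splits into the sets counted by the intersection numbers
    [pn i i (dist u v)]. *)
Lemma card_Dset x y x' y' : dist x y = dist x' y' -> #|D x y| = #|D x' y'|.
Proof.
move=> dE; suff h u v : #|T| = #|D u v| + \sum_(i < d.+1) pn i i (dist u v).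
  by apply/eqP; rewrite -(eqn_add2r (\sum_(i < d.+1) pn i i (dist x y))) -h dE -h.
rewrite -(cardsC (D u v)); congr (_ + _).
have -> : ~: D u v = [set w | dist u w == dist v w].
  by apply/setP => w; rewrite !inE negbK.
rewrite (sum_by_dist _ u); apply: eq_bigr => i _; rewrite -(pnE drg).
by apply: eq_card => w; rewrite !inE andbC; case: (dist u w =P i) => //= ->; rewrite eq_sym.
Qed.

Lemma Dset_tri x y z : #|D x z| <= #|D x y| + #|D y z|.
Proof.
apply: leq_trans (leq_card_setU _ _); apply: subset_leq_card; apply/subsetP => w.
by rewrite !inE; case: (dist x w =P dist y w) => [->|].
Qed.

Lemma Dset_moved (s : {perm T}) x : graph_aut e s -> #|D x (s x)| <= #|moved s|.
Proof.
move=> sA; apply: subset_leq_card; apply/subsetP => w; rewrite !inE; apply: contra => /eqP sw.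
by rewrite -{2}sw (aut_dist ec).
Qed.

Lemma connect_last (r : rel T) (P : T -> Prop) x :
  P x -> (forall y z, connect r x y -> P y -> r y z -> P z) ->
  forall y, connect r x y -> P y.
Proof.
move=> Px PS y /connectP[p rp ->].
suff : P (last x p) /\ connect r x (last x p) by case.
elim/last_ind: p rp => [|p z IH] /=; first by rewrite connect0.
rewrite rcons_path last_rcons => /andP[/IH[Pl cl] lz].
by split; [apply: PS lz|apply: connect_trans (connect1 lz)].
Qed.

Lemma dist_graph_sym i : symmetric (dist_graph e i).
Proof. by move=> x y; rewrite /dist_graph dC. Qed.

(** A path of the distance-[i] graph is copied from [x] to [x']: [transfer] yields a counterpart of
    its last but one vertex, and induction does the rest. *)
Lemma connect_dist i x y x' y' : dist x y = dist x' y' ->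
  connect (dist_graph e i) x y -> connect (dist_graph e i) x' y'.
Proof.
move=> dE cxy; move: y cxy y' dE; apply: connect_last => [y' /esym/eqP|].
  by rewrite (distxx ec) (dist_eq0 ec) => /eqP->.
move=> y z _ IH yz y' dE; have [y1 d1 d2] := transfer y dE.
apply: connect_trans (IH y1 (esym d1)) (connect1 _).
by rewrite /dist_graph dC d2 dC.
Qed.

(* The distances occurring in a component of the distance-i graph are reached
   by at most d+1 rounds of closure under adding one i-step. *)
Lemma Dset_connect i m u v : dist u v = i -> #|D u v| <= m ->
  forall x y, connect (dist_graph e i) x y -> #|D x y| <= d.+1 * m.
Proof.
move=> duv Dm.
pose stp (h j : 'I_d.+1) := [exists p : T * T * T, [&& dist p.1.1 p.1.2 == h,
  dist p.1.2 p.2 == i & dist p.1.1 p.2 == j]].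
pose F (S : {set 'I_d.+1}) := ord0 |: [set j | [exists h in S, stp h j]].
have Fm : {homo F : A B / A \subset B}.
  move=> A B AB; apply: setUS; apply/subsetP => j; rewrite !inE.
  case/existsP=> h /andP[hA hs]; apply/existsP; exists h; by rewrite (subsetP AB).
have bnd n j : j \in iter n F set0 -> forall x y, dist x y = j -> #|D x y| <= n * m.
  elim: n j => [|n IH] j; first by rewrite inE.
  rewrite /= inE in_set1 => /orP[/eqP->|jS] x y.
    move/eqP; rewrite (dist_eq0 ec) => /eqP->.
    by rewrite (_ : D y y = set0) ?cards0 //; apply/setP => w; rewrite !inE eqxx.
  move=> dxy; move: jS.
  rewrite inE => /existsP[h /andP[hS /existsP[[[a b] c] /= /and3P[/eqP d1 /eqP d2 /eqP d3]]]].
  rewrite (@card_Dset x y a c) ?dxy //.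
  apply: leq_trans (Dset_tri a b c) _; rewrite mulSn addnC leq_add ?(IH _ hS) //.
  by rewrite (@card_Dset b c u v) ?d2.
move=> x y cxy; have dy : dist x y < d.+1 by rewrite ltnS (le_diam drg).
apply: (bnd d.+1 (Ordinal dy)) => //.
have -> : iter d.+1 F set0 = fixset F by rewrite /fixset card_ord.
have <- : inord (dist x y) = Ordinal dy by apply: val_inj; rewrite /= inordK.
move: y cxy {dy}; apply: connect_last => [|y z _ yS yz]; rewrite -(fixsetK Fm) inE.
  by rewrite (distxx ec) in_set1 -val_eqE /= inordK.
apply/orP; right; rewrite inE; apply/existsP; exists (inord (dist x y)); rewrite yS /=.
apply/existsP; exists (x, y, z) => /=.
by rewrite !inordK ?ltnS ?(le_diam drg) // !eqxx andbT.
Qed.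

End DRGFacts.

(** * Smith's theorem *)

Section Smith.
Variables (T : finType) (e : rel T) (d : nat).
Hypothesis drg : distance_regular e d.
Hypothesis d3 : 3 <= d.
Notation dist := (gdist e).
Notation nb := (nb e).
Implicit Types x y z u v w : T.
Local Notation es := (drg_sym drg).
Local Notation ei := (drg_irr drg).
Local Notation ec := (drg_conn drg).
Local Notation dC := (distC es ec).

Hypothesis k3 : 3 <= nb 0 1.

Variable R : rel T.
Hypotheses (Rr : reflexive R) (Rs : symmetric R) (Rt : transitive R).
Hypothesis Rd : forall x y x' y', dist x y = dist x' y' -> R x y -> R x' y'.

Lemma two_of_card (P : pred T) : 1 < #|[set x | P x]| -> exists x y, [/\ x != y, P x & P y].
Proof.
by case/card_gt1P => x [y []]; rewrite !inE => Px Py xy; exists x, y.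
Qed.

Lemma class_edge x y : R x y -> e x y -> forall u v, R u v.
Proof.
move=> Rxy xy u v; apply: (@connect_last _ e (fun a => R u a) u _ _ v (ec u v)) => // a b _ Rua ab.
by apply: Rt Rua (Rd _ Rxy); rewrite !(dist1 ei ec).
Qed.

Lemma class_not_edge u v : ~~ R u v -> forall x y, R x y -> ~~ e x y.
Proof. by move=> nR x y Rxy; apply: contra nR => xy; exact: class_edge Rxy xy _ _. Qed.

(** Since [R] contains no edge, [nb m m] is 0. As the valency is at least 3, one of [nb m m.-1] and
    [nb m m.+1] is at least 2, and by monotonicity some vertex has two neighbours at distance [m]
    from a common [a]. These are related, hence not adjacent, hence at distance 2. *)
Lemma class_dist2 u v m x y : ~~ R u v -> R x y -> dist x y = m -> 0 < m < d ->
  exists a b, dist a b = 2 /\ R a b.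
Proof.
move=> nR Rxy dxy /andP[m0 md]; have nE := class_not_edge nR.
have R' a b : dist a b = m -> R a b by move=> dab; apply: (Rd _ Rxy); rewrite dxy.
have am : nb m m = 0.
  rewrite -{1}dxy -(nbE drg); apply/eqP; rewrite cards_eq0; apply/eqP/setP => w.
  rewrite !inE; apply/negP => /andP[yw /eqP xw].
  have Ryw : R y w by rewrite Rs in Rxy; apply: Rt Rxy (R' _ _ xw).
  by case/negP: (nE _ _ Ryw).
have two a w : 1 < #|[set z | e w z & dist a z == m]| -> exists z1 z2, dist z1 z2 = 2 /\ R z1 z2.
  case/two_of_card => z1 [z2 [z12 /andP[wz1 /eqP h1] /andP[wz2 /eqP h2]]].
  have Rz : R z1 z2 by apply: (@Rt a); rewrite ?(Rs z1); apply: R'.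
  exists z1, z2; split => //.
  have := nE _ _ Rz; rewrite -(dist_eq1 ei ec); have := dist_tri ec z1 w z2.
  rewrite (dist1 ei ec wz2) (dC z1 w) (dist1 ei ec wz1).
  move: z12; rewrite -(dist_eq0 ec); lia.
have := nb_sum drg (i := m); rewrite am m0 ltnW // => /(_ isT) ks.
case: (ltnP 1 (nb m m.-1)) => cm.
  have [a [w daw]] := dist_exists drg md.
  apply: (two a w); rewrite (nbE drg) daw; apply: leq_trans cm _.
  by case: (m) m0 md => //= m' _; apply: (c_monoS drg).
have bm : 1 < nb m m.+1 by lia.
have [|a [w daw]] := dist_exists drg (i := m.-1); first lia.
apply: (two a w); rewrite (nbE drg) daw; apply: leq_trans bm _.
by case: (m) m0 md => //= m' _ md; apply: (b_monoS drg); lia.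
Qed.

(** Take a geodesic [x0], [x1], [y], [v'] and a common neighbour [w] of [y] and [v']. Either [y] and
    [w] are both at distance 2 from [x0], or [v'] and [w] are both at distance 2 from [x1]; each way
    an edge is related. *)
Lemma dist2_triangle_free u v a b : ~~ R u v -> dist a b = 2 -> R a b -> nb 1 1 = 0.
Proof.
move=> nR dab Rab; have nE := class_not_edge nR.
have R' x y : dist x y = 2 -> R x y by move=> dxy; apply: (Rd _ Rab); rewrite dab.
have [x0 [v' dv']] := dist_exists drg d3.
case: (dist_pred ec dv') => y dy yv'.
have -> : nb 1 1 = nb (dist y v') 1 by rewrite (dist1 ei ec yv').
rewrite -(nbE drg); apply/eqP; rewrite -leqn0 leqNgt; apply/negP.
case/card_gt0P => w; rewrite inE (dist_eq1 ei ec) => /andP[v'w yw].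
have [h1 h2] := dist_adj es ec x0 v'w; have [h3 h4] := dist_adj es ec x0 yw.
have /orP[/eqP dw|/eqP dw] : (dist x0 w == 2) || (dist x0 w == 3) by lia.
  have /nE/negP[] // : R y w by apply: (@Rt x0); rewrite ?(Rs y); apply: R'.
case: (@dist_split _ _ ec x0 y 1); first lia.
move=> x1 d1 d1y.
have h p : e y p -> dist x0 p = 3 -> dist x1 p = 2.
  move=> yp dp; have := dist_tri ec x0 x1 p; have [] := dist_adj es ec x1 yp; lia.
have /nE/negP[] // : R v' w by apply: (@Rt x1); rewrite ?(Rs v'); apply: R'; exact: h.
Qed.

(** Without triangles a walk of length 2 ends at distance 0 or 2, so even distances are related, and
    a related pair at odd distance would make an edge related. An edge inside a sphere around [w]
    then contradicts one of these. *)
Lemma triangle_free_parity u v a b : ~~ R u v -> dist a b = 2 -> R a b ->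
  parity_graph e /\ (forall x y, R x y = ~~ odd (dist x y)).
Proof.
move=> nR dab Rab; have nE := class_not_edge nR.
have tf := dist2_triangle_free nR dab Rab.
have two x y z : e x y -> e y z -> R x z.
  move=> xy yz; have := dist_tri ec x y z; rewrite (dist1 ei ec xy) (dist1 ei ec yz) => le2.
  have [/eqP|d0] := posnP (dist x z); first by rewrite (dist_eq0 ec) => /eqP->.
  have [d1|d1] := eqVneq (dist x z) 1; last by apply: (Rd _ Rab); lia.
  have : 0 < #|[set w | e x w & e z w]|.
    by apply/card_gt0P; exists y; rewrite inE xy es yz.
  by rewrite (common_nbrsE drg) d1 tf.
have ev n : forall x y, dist x y = n -> ~~ odd n -> R x y.
  have [m] := ubnP n; elim: m n => // m IH [|[|n]] // mn x y dxy on.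
    by move/eqP: dxy; rewrite (dist_eq0 ec) => /eqP->.
  case: (dist_pred ec dxy) => y1 d1 y1y; case: (dist_pred ec d1) => y2 d2 y21.
  apply: (Rt (IH n _ x y2 d2 _)); last exact: two y21 y1y.
    by lia.
  by rewrite /= negbK in on.
have RE x y : R x y = ~~ odd (dist x y).
  apply/idP/idP => [Rxy|h]; last exact: ev h.
  apply/negP => o; case n: (dist x y) o => [//|m] /= o.
  case: (dist_pred ec n) => z dz zy.
  have Rxz := ev _ _ _ dz o.
  have Rzy : R z y by rewrite Rs in Rxz; apply: Rt Rxz Rxy.
  by case/negP: (nE _ _ Rzy).
split => // w x y xy.
have [h1 h2] := dist_adj es ec w xy.
have [E|] := eqVneq (dist w x) (dist w y); last by lia.
case o: (odd (dist w x)); last first.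
  have Rxy : R x y by apply: (@Rt w); rewrite ?(Rs x) RE -?E o.
  by case/negP: (nE _ _ Rxy).
case n: (dist w x) o => [//|m] /= o.
rewrite E in n; case: (dist_pred ec n) => z dz zy.
have Rxz : R x z by apply: two xy _; rewrite es.
have : R w x by apply: (@Rt z); rewrite ?(Rs z) // (ev _ _ _ dz) //; lia.
by rewrite RE E n /= o.
Qed.

Lemma smith_class i : 1 <= i <= d -> (forall x y, dist x y = i -> R x y) ->
  [\/ forall x y, R x y,
      i = d /\ (forall x y, R x y = (dist x y == 0) || (dist x y == d)) |
      [/\ parity_graph e, ~~ odd i & forall x y, R x y = ~~ odd (dist x y)]].
Proof.
move=> /andP[i0 id] Ri.
case: (boolP [forall x, forall y, R x y]) => [/forallP h|].
  by constructor 1 => x y; exact/forallP.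
rewrite negb_forall => /existsP[u]; rewrite negb_forall => /existsP[v nR].
case: (boolP [exists p : T * T, (R p.1 p.2) && (0 < dist p.1 p.2 < d)]).
  case/existsP=> [[x y]] /andP[Rxy h].
  have [a [b [dab Rab]]] := class_dist2 nR Rxy (erefl _) h.
  have [pg RE] := triangle_free_parity nR dab Rab.
  constructor 3; split => //; have [x' [y' dxy']] := dist_exists drg id.
  by rewrite -dxy' -RE; apply: Ri.
rewrite negb_exists => /forallP nR2.
have Rle x y : R x y -> (dist x y == 0) || (dist x y == d).
  move=> Rxy; have := nR2 (x, y); rewrite /= Rxy /=; have := le_diam drg x y; lia.
have [x' [y' dxy']] := dist_exists drg id.
have iE : i = d by have := Rle _ _ (Ri _ _ dxy'); rewrite dxy'; lia.
constructor 2; split => // x y; apply/idP/orP => [/Rle/orP//|[]].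
  by rewrite (dist_eq0 ec) => /eqP->.
by rewrite -iE => /eqP; apply: Ri.
Qed.

End Smith.

Section SmithConnect.
Variables (T : finType) (e : rel T) (d : nat).
Hypothesis drg : distance_regular e d.
Hypothesis d3 : 3 <= d.
Notation dist := (gdist e).
Local Notation es := (drg_sym drg).
Local Notation ei := (drg_irr drg).
Local Notation ec := (drg_conn drg).

Lemma smith i : 3 <= nb e 0 1 -> 1 <= i <= d ->
  let R := connect (dist_graph e i) in
  [\/ gconnected (dist_graph e i),
      i = d /\ (forall x y, R x y = (dist x y == 0) || (dist x y == d)) |
      [/\ parity_graph e, ~~ odd i & forall x y, R x y = ~~ odd (dist x y)]].
Proof.
move=> k3 id R; apply: (smith_class drg d3 k3) => //.
- by move=> x y; exact: (sym_connect_sym (dist_graph_sym drg i)).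
- by move=> y x z; exact: connect_trans.
- by move=> x y x' y' dE; exact: (connect_dist drg dE).
by move=> x y dxy; apply: connect1; rewrite /dist_graph dxy.
Qed.

(** Being moved spreads along edges: a fixed neighbour of [u] is also a neighbour of [s u], which
    would put [u] and [s u] within distance 2. *)
Lemma moved_all (s : {perm T}) : graph_aut e s -> s != 1%g ->
  (forall u, s u != u -> 3 <= dist u (s u)) -> moved s = setT.
Proof.
move=> sA s1 far.
have [u0 u0m] : exists u, s u != u.
  apply/existsP; rewrite -negb_forall; apply: contra s1 => /forallP h.
  by apply/eqP/permP => x; rewrite perm1; apply/eqP.
apply/setP => y; rewrite !inE.
apply: (@connect_last _ e (fun a => s a != a) u0 _ _ y (ec u0 y)) => // u w _ um uw.
apply/negP => /eqP sw; have := far u um.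
have := dist_tri ec u w (s u); rewrite -{2}sw (aut_dist ec) // (distC es ec w u).
by rewrite !(dist1 ei ec uw); lia.
Qed.

End SmithConnect.

(** * Bipartite graphs *)

Section DoubleCounting.
Variables (T : finType).

Lemma double_count_le (A B : {set T}) (r : rel T) (m M : nat) :
  (forall a, a \in A -> m <= #|[set b in B | r a b]|) ->
  (forall b, b \in B -> #|[set a in A | r a b]| <= M) ->
  #|A| * m <= #|B| * M.
Proof.
move=> hA hB; rewrite -!sum_nat_const.
apply: (@leq_trans (\sum_(a in A) #|[set b in B | r a b]|)); first exact: leq_sum.
apply: (@leq_trans (\sum_(b in B) #|[set a in A | r a b]|)); last exact: leq_sum.
under eq_bigr => a _ do rewrite card_sumb.
under [X in _ <= X]eq_bigr => b _ do rewrite card_sumb.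
rewrite big_mkcond [X in _ <= X]big_mkcond /=.
rewrite (eq_bigr (fun a => \sum_b [&& a \in A, b \in B & r a b])) => [|a _]; last first.
  by case: ifP => // _; rewrite big1.
rewrite exchange_big /= leq_eqVlt; apply/orP; left; apply/eqP; apply: eq_bigr => b _.
by case: ifP => _; [apply: eq_bigr|rewrite big1 // => a _; rewrite andbF].
Qed.

End DoubleCounting.

(** * Walks among the moved vertices and concentration on one sphere *)

Section Walk.
Variables (T : finType) (e : rel T) (d : nat).
Hypothesis drg : distance_regular e d.
Notation dist := (gdist e).
Notation nb := (nb e).
Notation k_ := (ksph e).
Local Notation es := (drg_sym drg).
Local Notation ei := (drg_irr drg).
Local Notation ec := (drg_conn drg).
Local Notation dC := (distC es ec).

(* Walking away from u0 inside M loses at most the fraction q / b_i of the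
   edges at the i-th step. *)
Lemma walk (M : {set T}) (q j : nat) (u0 : T) : u0 \in M -> j <= d ->
  (forall u, u \in M -> #|[set w | e u w & w \notin M]| <= q) ->
  (forall i, i < j -> 10 * q <= 9 * nb i i.+1) ->
  k_ j <= 10 ^ j * #|[set w in M | dist u0 w == j]|.
Proof.
move=> u0M jd Mq; elim: j jd => [|j IH] jd qb.
  rewrite (ksph0 drg) mul1n; apply/card_gt0P; exists u0.
  by rewrite inE u0M (distxx ec).
have {}IH := IH (ltnW jd) (fun i ij => qb i (leqW ij)).
have q10 := qb j (leqnn _).
have := @double_count_le _ [set w in M | dist u0 w == j] [set w in M | dist u0 w == j.+1] e
  (nb j j.+1 - q) (nb j.+1 j).
set A := #|_| in IH *; set B := #|_|.
have h1 a : a \in [set w in M | dist u0 w == j] ->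
    nb j j.+1 - q <= #|[set b in [set w in M | dist u0 w == j.+1] | e a b]|.
  rewrite inE => /andP[aM /eqP da]; rewrite leq_subLR -{1}da -(nbE drg).
  apply: leq_trans _ (leq_add (Mq a aM) (leqnn _)).
  apply: leq_trans _ (leq_card_setU _ _); apply: subset_leq_card; apply/subsetP => w.
  by rewrite !inE => /andP[-> ->]; rewrite !andbT /=; case: (w \in M).
have h2 b : b \in [set w in M | dist u0 w == j.+1] ->
    #|[set a in [set w in M | dist u0 w == j] | e a b]| <= nb j.+1 j.
  rewrite inE => /andP[aM /eqP da]; rewrite -da -(nbE drg).
  apply: subset_leq_card; apply/subsetP => w.
  by rewrite !inE es => /andP[/andP[_ ->] ->].
move=> /(_ h1 h2) AB.
(* At least a tenth of the edges leading outwards survive; comparing edge counts between consecutive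
   layers turns this into the factor 10 per layer. *)
rewrite -(leq_pmul2r (c_gt0 drg jd)) -(layer_edges drg) expnS.
have e1 : nb j j.+1 <= 10 * (nb j j.+1 - q) by lia.
apply: leq_trans (leq_mul IH e1) _.
by rewrite mulnACA [10 ^ j * 10]mulnC -[X in _ <= X]mulnA leq_mul2l AB orbT.
Qed.

Lemma fixed_nbrs (s : {perm T}) u : graph_aut e s ->
  #|[set w | e u w & w \notin moved s]| <= nb (dist u (s u)) 1.
Proof.
move=> sA; rewrite -(common_nbrsE drg); apply: subset_leq_card; apply/subsetP => w.
rewrite !inE negbK => /andP[uw /eqP sw]; rewrite uw /=.
by rewrite -sw sA.
Qed.

(** Averaging: each [y] in [H] disagrees with [x] at no more than [m] vertices of [W], and [H] is
    not larger than [W], so some [w] in [W] has all but [m] vertices of [H] at the distance of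
    [x]. *)
Lemma concentration (H W : {set T}) x m :
  0 < #|W| -> #|H| <= #|W| -> (forall y, y \in H -> #|Dset e x y| <= m) ->
  exists2 w, w \in W & #|H| <= k_ (dist w x) + m.
Proof.
move=> W0 HW Dm; case: (boolP [exists w in W, #|[set y in H | dist x w != dist y w]| <= m]).
  case/existsP=> w /andP[wW h]; exists w => //.
  rewrite -(ksphE drg _ w); apply: leq_trans _ (leq_add (leqnn _) h).
  apply: leq_trans _ (leq_card_setU _ _); apply: subset_leq_card; apply/subsetP => y yH.
  by rewrite !inE yH /= (dC w y) (dC w x) eq_sym orbN.
rewrite negb_exists => /forallP nW.
have : #|W| * m.+1 <= #|H| * m.
  apply: (@double_count_le _ W H (fun w y => dist x w != dist y w)) => [w wW|y yH].
    by have := nW w; rewrite wW /= -ltnNge.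
  apply: leq_trans (Dm y yH); apply: subset_leq_card; apply/subsetP => w.
  by rewrite !inE => /andP[].
by have := leq_mul HW (leqnn m); rewrite mulnS; lia.
Qed.

End Walk.

Section Bipartite.
Variables (T : finType) (e : rel T) (d : nat).
Hypothesis drg : distance_regular e d.
Hypothesis d3 : 3 <= d.
Hypothesis pg : parity_graph e.
Notation dist := (gdist e).
Notation nb := (nb e).
Notation k_ := (ksph e).
Local Notation es := (drg_sym drg).
Local Notation ei := (drg_irr drg).
Local Notation ec := (drg_conn drg).
Local Notation dC := (distC es ec).

Lemma parity_add w x y : odd (dist w y) = odd (dist w x) (+) odd (dist x y).
Proof.
apply: (@connect_last _ e (fun y => odd (dist w y) = odd (dist w x) (+) odd (dist x y)) x _ _ y (ec x y)).
  by rewrite (distxx ec) addbF.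
by move=> a b _ h ab; rewrite (pg w ab) h (pg x ab) addbN.
Qed.

Definition half x := [set y | ~~ odd (dist x y)].
Definition hcard := \sum_(i < d.+1 | ~~ odd i) k_ i.

Lemma half_card x : #|half x| = hcard.
Proof.
rewrite (sum_by_dist drg _ x) /hcard [RHS]big_mkcond; apply: eq_bigr => i _.
case: ifP => oi; last first.
  apply/eqP; rewrite cards_eq0; apply/eqP/setP => y; rewrite !inE.
  by apply/negP => /andP[oy /eqP dy]; rewrite dy oi in oy.
rewrite -(ksphE drg i x); apply: eq_card => y; rewrite !inE.
by case: eqP => [->|]; rewrite ?oi ?andbF.
Qed.

Lemma halfC x y : e x y -> ~: half x = half y.
Proof. by move=> xy; apply/setP => z; rewrite !inE negbK !(dC _ z) (pg z xy) negbK. Qed.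

Lemma card_halves : #|T| = 2 * hcard.
Proof.
have [x [y dxy]] : exists x y, dist x y = 1 by apply: (dist_exists drg); lia.
have xy : e x y by rewrite -(dist_eq1 ei ec) dxy.
by rewrite -(cardsC (half x)) (halfC xy) !half_card mul2n addnn.
Qed.

Lemma two_spheres i j : i != j -> odd i = odd j -> k_ i + k_ j <= hcard.
Proof.
move=> ij oij; have [x _] := dist_exists drg (leq0n d).
have [y xy] : exists y, e x y.
  by have [|y] := @extend _ _ _ drg x x; rewrite ?(distxx ec); [lia|exists y].
have dis : [disjoint [set w | dist x w == i] & [set w | dist x w == j]].
  apply/pred0P => w /=; rewrite !inE; apply/negP => /andP[/eqP h1 /eqP h2].
  by case/eqP: ij; rewrite -h1 -h2.
rewrite -!(ksphE drg _ x) -cardsUI (disjoint_setI0 dis) cards0 addn0.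
case o: (odd i); [rewrite -(half_card y) -(halfC xy)|rewrite -(half_card x)];
  apply: subset_leq_card; apply/subsetP => w; rewrite !inE => /orP[/eqP->|/eqP->];
  by rewrite -?oij o.
Qed.

Lemma nb_diag0 i : i <= d -> nb i i = 0.
Proof.
case/(dist_exists drg) => x [y <-]; rewrite -(nbE drg); apply/eqP; rewrite cards_eq0.
apply/eqP/setP => w; rewrite !inE; apply/negP => /andP[yw /eqP h].
by have := pg x yw; rewrite h; case: odd.
Qed.

Section Motion.
Variable s : {perm T}.
Hypotheses (sA : graph_aut e s) (s1 : s != 1%g).
Hypothesis k3 : 3 <= nb 0 1.
Notation M := (moved s).
Notation Delta := (d.+1 * #|M|).

(** A fixed [w] is equally far from [u] and [s u], so these would lie in the same half. *)
Lemma odd_displacement u : odd (dist u (s u)) -> #|M| = #|T|.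
Proof.
move=> o; rewrite -cardsT; congr #|pred_of_set _|; apply/setP => w; rewrite !inE.
apply/negP => /eqP sw; have := parity_add w u (s u).
by rewrite -{1}sw (aut_dist ec) // o addbT; case: odd.
Qed.

Hypothesis ev : forall u, ~~ odd (dist u (s u)).
Variable u2 : T.
Hypothesis du2 : dist u2 (s u2) = 2.

Lemma even_Dset x y : ~~ odd (dist x y) -> #|Dset e x y| <= Delta.
Proof.
move=> oxy; apply: (Dset_connect drg du2 (Dset_moved drg u2 sA)).
have [|h|[h _]|[_ _ ->]] := @smith _ _ _ drg d3 2 k3 => //; first lia.
by lia.
Qed.

Lemma concentrated : exists a b, [/\ ~~ odd a, odd b, a <= d, b <= d &
  hcard <= k_ a + Delta /\ hcard <= k_ b + Delta].
Proof.
have [x [y dxy]] : exists x y, dist x y = 1 by apply: (dist_exists drg); lia.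
have xy : e x y by rewrite -(dist_eq1 ei ec) dxy.
have hD z : z \in half x -> #|Dset e x z| <= Delta by rewrite inE; apply: even_Dset.
have h0 z : 0 < #|half z| by apply/card_gt0P; exists z; rewrite inE (distxx ec).
(* Taking [W] in each half in turn gives a large sphere of even radius and one of odd radius. *)
have [w1 w1x h1] := concentration drg (h0 x) (leqnn _) hD.
have [|w2 w2y h2] := concentration drg (h0 y) _ hD; first by rewrite !half_card.
rewrite half_card in h1 h2; rewrite inE dC in w1x; rewrite inE in w2y.
exists (dist w1 x), (dist w2 x); split=> //; rewrite ?(le_diam drg) //.
by rewrite dC (pg w2 xy) negbK in w2y.
Qed.

Hypothesis big : 40 * 10 ^ d * Delta < hcard.

Lemma big40 : 400 * Delta < hcard.
Proof.
apply: leq_ltn_trans big; rewrite leq_mul2r (_ : 400 = 40 * 10 ^ 1) // leq_mul2l leq_exp2l //.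
by rewrite (leq_trans _ d3) ?orbT.
Qed.

Lemma Delta_gt0 : 0 < Delta. Proof. by rewrite muln_gt0 moved_gt0. Qed.

(** If the large layers of even and odd index were not consecutive, both layers next to the even one
    would be small and could not absorb its edges. *)
Lemma two_layers : exists j, [/\ 0 < j, j.+1 <= d, hcard <= k_ j + Delta,
  hcard <= k_ j.+1 + Delta & forall i, i != j -> i != j.+1 -> k_ i <= Delta].
Proof.
have [a [b [oa ob ad bd [ha hb]]]] := concentrated.
have D0 := Delta_gt0; have b40 := big40.
have small i : i != a -> i != b -> k_ i <= Delta.
  move=> ia ib; have [oi|oi] := boolP (odd i).
    by have := @two_spheres i b ib; rewrite oi ob => /(_ erefl); lia.
  by have := @two_spheres i a ia; rewrite (negbTE oi) (negbTE oa) => /(_ erefl); lia.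
have a0 : 0 < a by rewrite lt0n; apply/eqP => a0; move: ha; rewrite a0 (ksph0 drg); lia.
have b0 : 0 < b by rewrite lt0n; apply/eqP => b0; rewrite b0 in ob.
have [ab|ab] := eqVneq b a.+1.
  by exists a; split; rewrite -?ab // => i ? ?; apply: small.
have [ba|ba] := eqVneq a b.+1.
  by exists b; split; rewrite -?ba // => i ? ?; apply: small.
have := nb_sum drg (i := a); rewrite a0 ad nb_diag0 // addn0 => /(_ isT) ks.
have e1 := layer_edges drg a a.+1; have e2 := layer_edges drg a a.-1.
have k1 : k_ a.+1 * nb a.+1 a <= Delta * nb 0 1.
  have [l|l] := leqP a.+1 d; last by rewrite (sphere_big drg).
  apply: leq_mul; first by apply: small; lia.
  exact: nb_le_valency drg _ _ _.
have k2 : k_ a.-1 * nb a.-1 a <= Delta * nb 0 1.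
  apply: leq_mul; first by apply: small; lia.
  by apply: (nb_le_valency drg); lia.
have : k_ a * nb 0 1 <= 2 * Delta * nb 0 1.
  by rewrite -{1}ks mulnDr e1 e2; lia.
by rewrite leq_pmul2r; lia.
Qed.

(** A small layer carries at most [Delta * nb 0 1] edges, and these are spread over at least
    [40 * Delta] vertices of the large layer beside it. *)
Lemma two_layers_deg j : 0 < j -> j.+1 <= d -> hcard <= k_ j + Delta ->
  hcard <= k_ j.+1 + Delta -> (forall i, i != j -> i != j.+1 -> k_ i <= Delta) ->
  40 * nb j j.-1 <= nb 0 1 /\ 40 * nb j.+1 j.+2 <= nb 0 1.
Proof.
move=> j0 jd h1 h2 small; have b40 := big40; have D0 := Delta_gt0; split.
  rewrite -(leq_pmul2l D0) mulnA.
  apply: leq_trans (_ : k_ j * nb j j.-1 <= _); first by rewrite leq_mul2r; apply/orP; right; lia.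
  rewrite (layer_edges drg); apply: leq_mul; first by apply: small; lia.
  by apply: (nb_le_valency drg); lia.
rewrite -(leq_pmul2l D0) mulnA.
apply: leq_trans (_ : k_ j.+1 * nb j.+1 j.+2 <= _); first by rewrite leq_mul2r; apply/orP; right; lia.
rewrite (layer_edges drg).
have [l|l] := leqP j.+2 d; last by rewrite (sphere_big drg).
by apply: leq_mul; [apply: small; lia|apply: (nb_le_valency drg); lia].
Qed.

Lemma moved_fixed_nbrs u : u \in M -> #|[set w | e u w & w \notin M]| <= nb 2 1.
Proof.
rewrite inE => um; apply: leq_trans (fixed_nbrs drg u sA) _.
have := ev u; have := le_diam drg u (s u); have : dist u (s u) != 0 by rewrite (dist_eq0 ec) eq_sym.
case: (dist u (s u)) => [|[|[|[|i]]]] //= _ id _.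
by rewrite (nb_far drg) ?id.
Qed.

(** If [j >= 2], then [nb 2 1] is at most the tiny [nb j j.-1], and the walk brings too many moved
    vertices into layer [j]. If [j = 1] and [d >= 4], then [nb 2 1 <= nb 2 3], although [nb 2 3] is
    tiny and the two add up to the valency. *)
Lemma bipartite_layer1 : hcard <= k_ 1 + Delta /\ hcard <= k_ 2 + Delta /\ d = 3.
Proof.
have [j [j0 jd h1 h2 small]] := two_layers.
have [c40 b40] := two_layers_deg j0 jd h1 h2 small.
have D0 := Delta_gt0; have B := big40.
have ks i : 0 < i <= d -> nb i i.-1 + nb i i.+1 = nb 0 1.
  by move=> id; have := nb_sum drg id; rewrite nb_diag0; [rewrite addn0|case/andP: id].
have [j1|j2] := leqP j 1.
  have j1E : j = 1 by lia.
  subst j; split=> //; split=> //; apply/eqP; rewrite eqn_leq d3 andbT leqNgt; apply/negP => d4.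
  have := @c_le_b _ _ _ drg 1 2 d4; have := ks 2; rewrite /= (leq_trans _ d3) // => /(_ isT); lia.
have u2M : u2 \in M by rewrite inE -(dist_eq0 ec) (distC es ec) du2.
have cj : nb 2 1 <= nb j j.-1.
  have := @c_mono _ _ _ drg 1 j.-1; rewrite (ltn_predK j2); apply; lia.
have qb i : i < j -> 10 * nb 2 1 <= 9 * nb i i.+1.
  move=> ij; have bij := @b_mono _ _ _ drg i j (ltnW ij) (ltnW jd).
  have := ks j; rewrite j0 ltnW // => /(_ isT); lia.
have kj := walk drg u2M (ltnW jd) moved_fixed_nbrs qb.
have h3 : k_ j <= 10 ^ d * Delta.
  apply: leq_trans kj _; apply: leq_mul; first by rewrite leq_exp2l // ltnW.
  apply: leq_trans (leq_pmull _ (ltn0Sn d)); apply: subset_leq_card.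
  by apply/subsetP => w; rewrite inE => /andP[].
have := big; have : Delta <= 10 ^ d * Delta by rewrite leq_pmull // expn_gt0.
rewrite -mulnA; lia.
Qed.

(* With k_1 and k_2 close to n/2 the distance-3 graph is sparse, so the walk is
   done there. *)
Lemma bipartite_k3 : d = 3 /\ k_ 3 = 1.
Proof.
have [h1 [h2 dE]] := bipartite_layer1; split=> //.
have D0 := Delta_gt0; have B := big40.
have k3s : k_ 3 <= Delta by have := @two_spheres 1 3 erefl erefl; lia.
have k30 : 0 < k_ 3 by apply: (ksph_gt0 drg); rewrite dE.
apply/eqP; rewrite eqn_leq k30 andbT leqNgt; apply/negP => k32.
have u2M : u2 \in M by rewrite inE -(dist_eq0 ec) (distC es ec) du2.
set p := pn e 3 3 2.
have pE x y : dist x y = 2 -> #|[set w | (dist x w == 3) && (dist y w == 3)]| = p.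
  by move=> dxy; rewrite (pnE drg) dxy.
have d2 x y : x != y -> ~~ odd (dist x y) -> dist x y = 2.
  rewrite -(dist_eq0 ec); have := le_diam drg x y; rewrite dE.
  by case: (dist x y) => [|[|[|[|]]]].
have S3 x : #|[set w | dist x w == 3]| = k_ 3 by rewrite (ksphE drg).
have even33 x w y : dist x w = 3 -> dist w y = 3 -> ~~ odd (dist x y).
  by move=> e1 e2; rewrite (parity_add _ w) e1 e2.
(* Counting the two-step walks of the distance-3 graph from [u2] to other vertices gives equality of
   both products; [e2] is the converse inequality. *)
have e1 : k_ 2 * p <= k_ 3 * (k_ 3).-1.
  rewrite -(ksphE drg 2 u2) -(ksphE drg 3 u2).
  apply: (@double_count_le _ _ _ (fun x w => dist x w == 3)) => [a|b].
    rewrite inE => /eqP da; rewrite -(pE _ _ da); apply: subset_leq_card.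
    by apply/subsetP => w; rewrite !inE.
  rewrite inE => /eqP db; have := cardsD1 u2 [set w | dist b w == 3].
  rewrite S3 inE dC db eqxx add1n S3 => ->; apply: subset_leq_card; apply/subsetP => w.
  rewrite !inE => /andP[/eqP dw wb]; rewrite dC wb andbT.
  by apply/eqP => wE; move: dw; rewrite wE (distxx ec).
have e2 : k_ 3 * (k_ 3).-1 <= k_ 2 * p.
  rewrite -(ksphE drg 2 u2) -{1}(ksphE drg 3 u2).
  apply: (@double_count_le _ _ _ (fun x w => dist x w == 3)) => [a|b].
    rewrite inE => /eqP da; have := cardsD1 u2 [set w | dist a w == 3].
    rewrite S3 inE dC da eqxx add1n => ->; apply: subset_leq_card; apply/subsetP => w.
    rewrite !inE => /andP[wu /eqP aw]; rewrite aw eqxx andbT; apply/eqP; apply: d2.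
      by rewrite eq_sym.
    exact: even33 da aw.
  rewrite inE => /eqP db; rewrite -(pE _ _ db); apply: subset_leq_card.
  by apply/subsetP => w; rewrite !inE (dC w b).
have fixp u : u \in M -> #|[set w | dist u w == 3 & w \notin M]| <= p.
  rewrite inE => um; rewrite -(pE u (s u)); last by apply: d2; rewrite // eq_sym.
  apply: subset_leq_card; apply/subsetP => w; rewrite !inE negbK => /andP[uw /eqP sw].
  by rewrite uw -sw (aut_dist ec).
have stay u : u \in M -> k_ 3 <= p + #|[set w in M | dist u w == 3]|.
  move=> uM; apply: leq_trans (leq_add (fixp u uM) (leqnn _)).
  rewrite -(S3 u); apply: leq_trans _ (leq_card_setU _ _); apply: subset_leq_card.
  by apply/subsetP => w; rewrite !inE => ->; rewrite andbT /= orNb.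
(* A moved vertex has at most [p] fixed vertices at distance 3, so nearly all two-step walks from
   [u2] stay in [M], and each endpoint is reached at most [p] times. *)
have e3 : #|[set w in M | dist u2 w == 3]| * ((k_ 3).-1 - p) <= #|[set x in M | dist u2 x == 2]| * p.
  apply: (@double_count_le _ _ _ (fun x w => dist x w == 3)) => [a|b].
    rewrite inE => /andP[aM /eqP da].
    have := cardsD1 u2 [set w in M | dist a w == 3]; rewrite inE u2M dC da eqxx add1n => E.
    have := stay a aM; rewrite E => st.
    apply: leq_trans (_ : #|[set w in M | dist a w == 3] :\ u2| <= _); first lia.
    apply: subset_leq_card; apply/subsetP => w.
    rewrite !inE => /and3P[wu wM /eqP aw]; rewrite wM aw eqxx andbT; apply/eqP; apply: d2.
      by rewrite eq_sym.
    exact: even33 da aw.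
  rewrite inE => /andP[_ /eqP db]; rewrite -(pE _ _ db); apply: subset_leq_card.
  by apply/subsetP => w; rewrite !inE => /andP[/andP[_ ->]]; rewrite (dC w b).
have le : #|[set x in M | dist u2 x == 2]| <= Delta.
  apply: leq_trans (leq_pmull _ (ltn0Sn d)); apply: subset_leq_card.
  by apply/subsetP => w; rewrite inE => /andP[].
have st := stay _ u2M.
(* Through [e1], the ratio of [k_ 2] to [k_ 3], at least 40, becomes a bound on [p]. *)
have p40 : 40 * p <= (k_ 3).-1.
  rewrite -(leq_pmul2l k30); apply: leq_trans e1; rewrite mulnA leq_mul2r.
  by apply/orP; right; lia.
have p0 : 0 < p by rewrite lt0n; apply/eqP => p0; move: e2; rewrite p0 muln0; nia.
have : k_ 3 * (k_ 3).-1 <= 4 * (#|[set w in M | dist u2 w == 3]| * ((k_ 3).-1 - p)) by nia.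
have : #|[set x in M | dist u2 x == 2]| * p <= Delta * p by rewrite leq_mul2r le orbT.
have : 4 * Delta * p < k_ 2 * p by rewrite ltn_pmul2r //; lia.
lia.
Qed.

End Motion.
End Bipartite.

(** * Recognising cocktail-party graphs *)

Section Cocktail.
Variables (T : finType) (e : rel T).
Hypothesis drg : distance_regular e 3.
Hypothesis pg : parity_graph e.
Hypothesis k31 : ksph e 3 = 1.
Notation dist := (gdist e).
Local Notation es := (drg_sym drg).
Local Notation ei := (drg_irr drg).
Local Notation ec := (drg_conn drg).
Local Notation dC := (distC es ec).

Lemma mate_ex x : exists y, [set w | dist x w == 3] == [set y].
Proof.
have /cards1P[y ->] : #|[set w | dist x w == 3]| == 1 by rewrite (ksphE drg) k31.
by exists y.
Qed.

Definition mate x := xchoose (mate_ex x).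

Lemma mateP x w : (dist x w == 3) = (w == mate x).
Proof. by have /eqP/setP/(_ w) := xchooseP (mate_ex x); rewrite !inE. Qed.

Lemma mate_dist x : dist x (mate x) = 3.
Proof. by apply/eqP; rewrite mateP. Qed.

Lemma mateK : involutive mate.
Proof. by move=> x; apply/esym/eqP; rewrite -mateP dC mate_dist. Qed.

Lemma cocktail_edge x y : e x y = odd (dist x y) && (y != mate x).
Proof.
rewrite -mateP -(dist_eq1 ei ec); have := le_diam drg x y.
by case: (dist x y) => [|[|[|[|]]]].
Qed.

Lemma cocktail : is_cocktail_party e.
Proof.
have [x0 _] := dist_exists drg (leq0n 3).
pose A := half e x0.
have x0A : x0 \in A by rewrite inE (distxx ec).
have oA x y : odd (dist x y) = ((x \in A) != (y \in A)).
  by rewrite !inE (parity_add drg pg x x0 y) (dC x x0); do 2!case: odd.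
(* A vertex outside [A] is labelled by its mate, so mates share the second coordinate and form the
   removed matching. *)
pose h x := if x \in A then x else mate x.
have mA x : (mate x \in A) = (x \notin A).
  by have := oA x (mate x); rewrite mate_dist /=; do 2!case: (_ \in A).
have hA x : h x \in A by rewrite /h; case: ifP => // xA; rewrite mA xA.
exists #|A|; exists (fun x => (x \in A, enum_rank_in x0A (h x))); split.
  exists (fun p : bool * 'I_#|A| => if p.1 then enum_val p.2 else mate (enum_val p.2)).
    move=> x /=; rewrite enum_rankK_in // /h; case: (x \in A) => //=; exact: mateK.
  move=> [b i] /=; have iA := enum_valP i; case: b => /=.
    by rewrite /h iA enum_valK_in.
  by rewrite /h mA iA /= mateK enum_valK_in.
move=> x y; rewrite /cocktail_rel /= cocktail_edge oA; case: eqVneq => //= xyA.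
have -> : (enum_rank_in x0A (h x) == enum_rank_in x0A (h y)) = (h x == h y).
  apply/eqP/eqP => [E|-> //].
  by rewrite -(enum_rankK_in x0A (hA x)) E enum_rankK_in.
congr (~~ _); rewrite /h; case xA: (x \in A) xyA; case yA: (y \in A) => //= _.
by rewrite -(inj_eq (inv_inj mateK)) mateK eq_sym.
Qed.

End Cocktail.

(** An odd displacement anywhere, or the absence of displacement 2, makes every vertex move;
    otherwise the large layers decide. The factor 80 is twice 40 because [hcard] counts half of the
    vertices. *)
Lemma bipartite_motion (T : finType) (e : rel T) d (s : {perm T}) :
  distance_regular e d -> 3 <= d -> parity_graph e -> 3 <= nb e 0 1 ->
  graph_aut e s -> s != 1%g ->
  #|T| <= 80 * 10 ^ d * d.+1 * #|moved s| \/ is_cocktail_party e.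
Proof.
move=> drg d3 pg k3 sA s1.
have D0 : 0 < 80 * 10 ^ d * d.+1 by rewrite !muln_gt0 expn_gt0.
have trivial : #|moved s| = #|T| -> #|T| <= 80 * 10 ^ d * d.+1 * #|moved s|.
  by move=> ->; rewrite leq_pmull.
case: (boolP [exists u, odd (gdist e u (s u))]) => [/existsP[u o]|].
  left; apply: trivial; exact: (odd_displacement drg pg sA o).
rewrite negb_exists => /forallP ev.
case: (boolP [exists u, gdist e u (s u) == 2]) => [/existsP[u2 /eqP du2]|]; last first.
  rewrite negb_exists => /forallP n2; left; apply: trivial.
  rewrite (moved_all drg d3 sA s1) ?cardsT // => u su.
  have := ev u; have := n2 u; have : gdist e u (s u) != 0.
    by rewrite (dist_eq0 (drg_conn drg)) eq_sym.
  by case: (gdist e u (s u)) => [|[|[|]]].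
have [big|small] := ltnP (40 * 10 ^ d * (d.+1 * #|moved s|)) (hcard e d).
  right; have [dE k31] := bipartite_k3 drg d3 pg sA s1 k3 ev du2 big.
  by move: drg; rewrite dE => drg'; apply: cocktail drg' pg k31.
left; rewrite (card_halves drg _ pg); last lia.
by have := leq_mul (leqnn 2) small; rewrite !mulnA.
Qed.

(** * Graphs that are locally two cliques *)

Definition nbhd (T : finType) (e : rel T) z := [set w | e z w].
Definition clique (T : finType) (e : rel T) (A : {set T}) :=
  forall x y, x \in A -> y \in A -> x != y -> e x y.

Section TwoCliques.
Variables (T : finType) (e : rel T) (d : nat).
Hypothesis drg : distance_regular e d.
Hypothesis d3 : 3 <= d.
Notation dist := (gdist e).
Notation nb := (nb e).
Notation k := (nb 0 1).
Notation lam := (nb 1 1).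
Notation mu := (nb 2 1).
Notation N := (nbhd e).
Local Notation es := (drg_sym drg).
Local Notation ei := (drg_irr drg).
Local Notation ec := (drg_conn drg).
Local Notation dC := (distC es ec).

Definition nonnbrs z y := [set w in N z | (w != y) && ~~ e y w].
Notation B := nonnbrs.

Lemma card_nbhd z : #|N z| = k.
Proof. exact: (valencyE drg). Qed.

Lemma edge_neq x y : e x y -> x != y.
Proof. by apply: contraTneq => ->; rewrite ei. Qed.

Lemma common_edge x y : e x y -> #|N x :&: N y| = lam.
Proof.
move=> xy; have -> : lam = nb (dist x y) 1 by rewrite (dist1 ei ec xy).
rewrite -(common_nbrsE drg); apply: eq_card => w.
by rewrite !inE.
Qed.

Lemma dist_two x y z : x != y -> ~~ e x y -> e z x -> e z y -> dist x y = 2.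
Proof.
rewrite -(dist_eq0 ec) -(dist_eq1 ei ec) => h0 h1 zx zy.
have := dist_tri ec x z y; rewrite (dC x z) (dist1 ei ec zx) (dist1 ei ec zy); lia.
Qed.

Lemma common_nonedge x y z : x != y -> ~~ e x y -> e z x -> e z y -> #|N x :&: N y| = mu.
Proof.
move=> xy nxy zx zy; rewrite -(dist_two xy nxy zx zy) -(common_nbrsE drg); apply: eq_card => w.
by rewrite !inE.
Qed.

Lemma common_nonedge_in z x y : x \in N z -> y \in N z -> x != y -> ~~ e x y ->
  #|N z :&: N x :&: N y| < mu.
Proof.
rewrite !inE => zx zy xy nxy; rewrite -(common_nonedge xy nxy zx zy).
apply: proper_card; apply/properP; split.
  by apply/subsetP => w; rewrite !inE -andbA => /and3P[_ -> ->].
by exists z; rewrite !inE ?(es _ z) ?zx ?zy // ei.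
Qed.

Lemma card_nonnbrs z y : y \in N z -> #|B z y| + lam + 1 = k.
Proof.
rewrite inE => zy; rewrite -(card_nbhd z) -(common_edge zy) (cardsD1 y (N z)) inE zy addnC; congr (_ + _).
rewrite addnC -(cardsID (N y) (N z :\ y)); congr (_ + _); apply: eq_card => w; rewrite !inE.
  case: eqVneq => [->|_]; last by rewrite andbC.
  by rewrite ei andbF.
by rewrite andbA andbC; case: (e z w); case: (w != y).
Qed.

Lemma nonnbrs_sym z x y : x \in N z -> y \in B z x -> x \in B z y.
Proof. by rewrite !inE => zx /and3P[zy h nh]; rewrite zx eq_sym h es. Qed.

(** Two non-adjacent neighbours of [z] each have [lam] neighbours inside [N z], and fewer than [mu]
    of these are shared, because [z] itself is a further common neighbour. *)
Lemma two_lam z : (exists y, y \in N z /\ B z y != set0) -> 2 * lam <= k + mu.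
Proof.
case=> v [vz /set0Pn[w wB]].
have := wB; rewrite inE => /and3P[wz wv nvw]; rewrite eq_sym in wv.
have h := common_nonedge_in vz wz wv nvw.
have := cardsUI (N z :&: N v) (N z :&: N w).
have [zv zw] : e z v /\ e z w by rewrite !inE in vz wz.
rewrite (common_edge zv) (common_edge zw).
have : #|N z :&: N v :|: N z :&: N w| <= k.
  by rewrite -(card_nbhd z); apply: subset_leq_card; rewrite subUset !subsetIl.
have : #|N z :&: N v :&: (N z :&: N w)| <= #|N z :&: N v :&: N w|.
  by apply: subset_leq_card; apply/subsetP => x; rewrite !inE; case: (e z x).
lia.
Qed.

Lemma mu_gt0 : 0 < mu. Proof. by apply: (c_gt0 drg); lia. Qed.

Lemma nonnbrs_gt0 z y : y \in N z -> 0 < #|B z y|.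
Proof.
rewrite inE => zy; have := b_gt0 drg (leq_trans (isT : 2 <= 3) d3).
have -> : nb 1 2 = nb (dist z y) 2 by rewrite (dist1 ei ec zy).
rewrite -(nbE drg) => /card_gt0P[u]; rewrite inE => /andP[yu /eqP zu].
have := card_nonnbrs (z := y) (y := z); have := card_nonnbrs (z := z) (y := y).
rewrite !inE zy es zy => /(_ isT) h1 /(_ isT) h2.
suff : 0 < #|B y z| by lia.
apply/card_gt0P; exists u; rewrite !inE yu -(dist_eq1 ei ec) zu andbT.
by rewrite -(dist_eq0 ec) dC zu.
Qed.

Lemma lam_half : 2 * lam <= k + mu.
Proof.
have [z [y zy]] : exists z y, dist z y = 1 by apply: (dist_exists drg); lia.
have yz : y \in N z by rewrite inE -(dist_eq1 ei ec) zy.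
by apply: (@two_lam z); exists y; split; rewrite // -card_gt0 nonnbrs_gt0.
Qed.

Hypothesis mu_small : 1000 * mu <= k.
Hypothesis lam_big : 2 * k < 5 * lam.

(** Three sets of size [lam] inside [N z] that pairwise share fewer than [mu] vertices would need
    more than [3 * lam - 3 * mu] vertices, which exceeds [k] as [lam] is above 2k/5. *)
Lemma claw_free z x y w : x \in N z -> y \in N z -> w \in N z ->
  y \in B z x -> w \in B z x -> w \in B z y -> False.
Proof.
move=> xz yz wz; rewrite !inE => /and3P[_ yx nxy] /and3P[_ wx nxw] /and3P[_ wy nyw].
rewrite eq_sym in yx; rewrite eq_sym in wx; rewrite eq_sym in wy.
have h1 := @common_nonedge_in z x y xz yz yx nxy.
have h2 := @common_nonedge_in z x w xz wz wx nxw.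
have h3 := @common_nonedge_in z y w yz wz wy nyw.
set X := N z :&: N x in h1 h2; set Y := N z :&: N y in h3; set W := N z :&: N w.
have [cX cY cW] : [/\ #|X| = lam, #|Y| = lam & #|W| = lam].
  by rewrite !inE in xz yz wz; rewrite !common_edge.
have : #|X :|: Y :|: W| <= k.
  by rewrite -(card_nbhd z); apply: subset_leq_card; rewrite !subUset !subsetIl.
have := cardsUI X Y; have := cardsUI (X :|: Y) W; rewrite cX cY cW.
have : #|X :&: Y| <= #|X :&: N y|.
  by apply: subset_leq_card; apply/subsetP => t; rewrite !inE => /andP[-> /andP[_ ->]].
have : #|(X :|: Y) :&: W| <= #|X :&: N w| + #|Y :&: N w|.
  apply: leq_trans _ (leq_card_setU _ _); apply: subset_leq_card; apply/subsetP => t.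
  by rewrite !inE => /andP[/orP[|] /andP[-> ->] /andP[_ ->]]; rewrite ?orbT.
lia.
Qed.

Lemma nonnbrs_disjoint z v p q : v \in N z -> p \in B z v -> q \in B z p -> q \in B z v -> False.
Proof.
move=> vz pv qp qv; have [pz qz] : p \in N z /\ q \in N z.
  by move: pv qv; rewrite !inE => /andP[-> _] /andP[-> _].
exact: (claw_free vz pz qz pv qv qp).
Qed.

Section Split.
Variables z v w : T.
Hypotheses (vz : v \in N z) (wv : w \in B z v).

Lemma split_w : w \in N z. Proof. by move: wv; rewrite !inE => /andP[]. Qed.

(** A neighbour of [z] outside both sets is a common neighbour of [v] and [w], since [v] and [w]
    themselves lie in the sets. *)
Lemma split_rest : #|N z :\: (B z v :|: B z w)| < mu.
Proof.
have := wv; rewrite inE eq_sym => /and3P[wz vw nvw].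
apply: leq_ltn_trans (common_nonedge_in vz wz vw nvw); apply: subset_leq_card; apply/subsetP => t.
rewrite !inE => /andP[]; case zt: (e z t) => //=.
case: (eqVneq t v) => [->|tv] /=; first by rewrite (es w) nvw vw.
case: (eqVneq t w) => [->|tw] /=; first by rewrite nvw.
by rewrite negb_or !negbK.
Qed.

(** By claw-freeness [B z p] avoids [B z v], so it lies in [B z w] up to the few vertices of
    [split_rest]. *)
Lemma split_near p : p \in B z v -> #|B z p :\: B z w| < mu.
Proof.
move=> pv; apply: leq_ltn_trans split_rest; apply: subset_leq_card; apply/subsetP => t.
rewrite in_setD => /andP[tw tp]; rewrite in_setD in_setU negb_or tw andbT.
apply/andP; split; last by move: tp; rewrite !inE => /andP[].
by apply/negP => tv; exact: (nonnbrs_disjoint vz pv tp tv).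
Qed.

Lemma split_far p : p \in B z v -> #|B z w :\: B z p| < mu.
Proof.
move=> pv; have := split_near pv.
have pz : p \in N z by move: pv; rewrite !inE => /andP[].
have := card_nonnbrs pz; have := card_nonnbrs split_w.
have := cardsID (B z w) (B z p); have := cardsID (B z p) (B z w); rewrite setIC; lia.
Qed.
End Split.

(** The clique on the side of [v]: nearly all of the opposite clique is [B z v], so a vertex with a
    non-neighbour there belongs with [v]. *)
Definition touches z v := [set y in N z | B z y :&: B z v != set0].

(** With non-neighbours [p] and [p'] of [y] on the two sides, [B z y] avoids [B z p] and [B z p'],
    which nearly fill [B z w] and [B z v]. Fewer than [3 * mu] vertices remain, but [B z y] has
    about half the valency or more. *)
Lemma touches_not_both z v w y : v \in N z -> w \in B z v -> y \in touches z v ->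
  y \in touches z w -> False.
Proof.
move=> vz wv; rewrite in_set => /andP[yz /set0Pn[p]]; rewrite in_setI => /andP[py pv].
rewrite in_set => /andP[_ /set0Pn[p']]; rewrite in_setI => /andP[py' pw'].
have zy : e z y by rewrite inE in yz.
have yzN : y \in N z by rewrite inE.
have wz := split_w wv; have vw := nonnbrs_sym vz wv.
have h1 := split_far vz wv pv; have h2 := split_far wz vw pw'.
have h3 := split_rest vz wv.
have : #|B z y| <= #|N z :\: (B z v :|: B z w)| + (#|B z v :\: B z p'| + #|B z w :\: B z p|).
  apply: leq_trans _ (leq_add (leqnn _) (leq_card_setU _ _)).
  apply: leq_trans _ (leq_card_setU _ _); apply: subset_leq_card; apply/subsetP => t ty.
  have tp : t \notin B z p by apply/negP => tp; exact: (nonnbrs_disjoint yzN py tp ty).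
  have tp' : t \notin B z p' by apply/negP => tp'; exact: (nonnbrs_disjoint yzN py' tp' ty).
  have tz : t \in N z by move: ty; rewrite !inE => /andP[].
  rewrite in_setU in_setD in_setU [t \in _ :|: _]in_setU !in_setD tz tp tp' /=.
  by case: (t \in B z v); case: (t \in B z w).
have := card_nonnbrs yzN; have := lam_half; lia.
Qed.

Lemma touches_cover z v w y : v \in N z -> w \in B z v -> y \in N z ->
  (y \in touches z v) || (y \in touches z w).
Proof.
move=> vz wv yz; rewrite !in_set; move: (yz); rewrite inE => zy; rewrite zy /=.
apply/norP => -[]; rewrite !negbK => /eqP E1 /eqP E2.
have : #|B z y| <= #|N z :\: (B z v :|: B z w)|.
  apply: subset_leq_card; apply/subsetP => t ty; rewrite in_setD in_setU.
  have -> : t \in N z by move: ty; rewrite !inE => /andP[].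
  rewrite andbT; apply/norP; split; apply/negP => tB.
    by have : t \in B z y :&: B z v; [rewrite in_setI ty|rewrite E1 inE].
  by have : t \in B z y :&: B z w; [rewrite in_setI ty|rewrite E2 inE].
have := split_rest vz wv; have := card_nonnbrs yz; have := lam_half; lia.
Qed.

(** For non-adjacent [x] and [y] the sets [B z x] and [B z y] are disjoint by claw-freeness, yet
    both lie almost inside [B z v], which has the same size as each. *)
Lemma touches_clique z v w : v \in N z -> w \in B z v -> clique e (touches z v).
Proof.
move=> vz wv x y xt yt xy; apply/negPn/negP => nxy.
have in1 t : t \in touches z v -> t \in N z /\ #|B z t :\: B z v| < mu.
  move=> tt; have tz : t \in N z by move: tt; rewrite in_set => /andP[].
  split=> //; apply: leq_ltn_trans (split_rest vz wv); apply: subset_leq_card.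
  apply/subsetP => q; rewrite in_setD => /andP[qv qt]; rewrite in_setD in_setU (negbTE qv) /=.
  have -> : q \in N z by move: qt; rewrite !inE => /andP[].
  rewrite andbT; apply/negP => qw; apply: (touches_not_both vz wv tt).
  by rewrite in_set tz; apply/set0Pn; exists q; rewrite in_setI qt.
have [xz hx] := in1 x xt; have [yz hy] := in1 y yt.
have cx := cardsID (B z v) (B z x); have cy := cardsID (B z v) (B z y).
have := card_nonnbrs xz; have := card_nonnbrs yz; have := card_nonnbrs vz.
have := cardsUI (B z x :&: B z v) (B z y :&: B z v).
have : #|B z x :&: B z v :|: B z y :&: B z v| <= #|B z v|.
  by apply: subset_leq_card; rewrite subUset !subsetIr.
have -> : #|B z x :&: B z v :&: (B z y :&: B z v)| = 0.
  apply/eqP; rewrite cards_eq0; apply/eqP/setP => q; rewrite [in RHS]inE; apply/negP.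
  rewrite !in_setI => /andP[/andP[qx _] /andP[qy _]].
  have qz : q \in N z by move: qx; rewrite !inE => /andP[].
  have yx : y \in B z x by rewrite in_set yz eq_sym xy nxy.
  exact: (claw_free xz yz qz yx qx qy).
have := lam_half; lia.
Qed.

Lemma two_cliques z : exists PQ : {set T} * {set T},
  [/\ PQ.1 :|: PQ.2 = N z, clique e PQ.1 & clique e PQ.2].
Proof.
have k0 : 0 < k by have := mu_gt0; lia.
have [v vz] : exists v, v \in N z by apply/card_gt0P; rewrite card_nbhd.
have [w wv] : exists w, w \in B z v by apply/card_gt0P; apply: nonnbrs_gt0.
have wz := split_w wv; have vw := nonnbrs_sym vz wv.
exists (touches z v, touches z w); split; last 2 first.
- exact: touches_clique vz wv.
- exact: touches_clique wz vw.
apply/setP => y; rewrite in_setU; apply/orP/idP => [|yz]; first by case; rewrite in_set => /andP[].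
by apply/orP; apply: touches_cover.
Qed.

End TwoCliques.

(** * The geometry with two lines on each point *)

Section Lines.
Variables (T : finType) (e : rel T) (d : nat).
Hypothesis drg : distance_regular e d.
Hypothesis d3 : 3 <= d.
Notation dist := (gdist e).
Notation nb := (nb e).
Notation k := (nb 0 1).
Notation lam := (nb 1 1).
Notation mu := (nb 2 1).
Notation N := (nbhd e).
Local Notation es := (drg_sym drg).
Local Notation ei := (drg_irr drg).
Local Notation ec := (drg_conn drg).
Local Notation dC := (distC es ec).
Notation B := (nonnbrs e).
Hypothesis mu_small : 1000 * mu <= k.
Hypothesis lam_big : 2 * k < 5 * lam.
Variables P Q : T -> {set T}.
Hypothesis PQ : forall z, P z :|: Q z = N z.
Hypothesis Pc : forall z, clique e (P z).
Hypothesis Qc : forall z, clique e (Q z).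

Definition side z y := if y \in P z then P z else Q z.
Definition coside z y := if y \in P z then Q z else P z.
Definition line z y := z |: side z y.

Lemma sideU z y : side z y :|: coside z y = N z.
Proof. by rewrite /side /coside; case: ifP => _; rewrite // setUC PQ. Qed.

Lemma side_clique z y : clique e (side z y).
Proof. by rewrite /side; case: ifP. Qed.

Lemma coside_clique z y : clique e (coside z y).
Proof. by rewrite /coside; case: ifP. Qed.

Lemma side_sub z y w : w \in side z y -> e z w.
Proof. by move=> h; have : w \in N z; [rewrite -(sideU z y) inE h|rewrite inE]. Qed.

Lemma coside_sub z y w : w \in coside z y -> e z w.
Proof. by move=> h; have : w \in N z; [rewrite -(sideU z y) inE h orbT|rewrite inE]. Qed.

Lemma mem_side z y : e z y -> y \in side z y.
Proof.
move=> zy; rewrite /side; case: ifP => // h.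
by have : y \in N z; [rewrite inE|rewrite -PQ in_setU h].
Qed.

(* A point of one clique has a non-neighbour s in the other, so its neighbours
   there are common neighbours of it and s. *)
Lemma cross z (A A' : {set T}) p : A :|: A' = N z -> clique e A -> clique e A' ->
  p \in A -> (p \notin A') /\ #|A' :&: N p| < mu.
Proof.
move=> AA cA cA' pA.
have pz : p \in N z by rewrite -AA in_setU pA.
have /card_gt0P[s sB] := nonnbrs_gt0 drg d3 pz.
have := sB; rewrite inE => /and3P[sz sp nps].
have sA : s \notin A by apply/negP => sA; case/negP: nps; apply: cA => //; rewrite eq_sym.
have sA' : s \in A' by move: sz; rewrite -AA in_setU (negbTE sA).
split; first by apply/negP => pA'; case/negP: nps; apply: cA' => //; rewrite eq_sym.
rewrite eq_sym in sp; apply: leq_ltn_trans (common_nonedge_in drg d3 pz sz sp nps).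
apply: subset_leq_card; apply/subsetP => t; rewrite in_setI => /andP[tA' pt].
have tz : t \in N z by rewrite -AA in_setU tA' orbT.
rewrite !in_setI tz pt /= inE; apply: cA' => //; apply: contraNneq nps => ->.
by rewrite inE in pt.
Qed.

Lemma cross_side z y p : p \in side z y -> p \notin coside z y /\ #|coside z y :&: N p| < mu.
Proof. exact: cross (sideU z y) (@side_clique z y) (@coside_clique z y). Qed.

Lemma cross_coside z y p : p \in coside z y -> p \notin side z y /\ #|side z y :&: N p| < mu.
Proof. by apply: cross (@coside_clique z y) (@side_clique z y); rewrite setUC sideU. Qed.

Lemma side_eq z y w : w \in side z y -> side z w = side z y.
Proof.
move=> h; have [nw _] := cross_side h; move: h nw; rewrite /side /coside.
case: ifP => _ h; first by rewrite h.
by move=> /negbTE ->.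
Qed.

Lemma coside_eq z y w : w \in coside z y -> side z w = coside z y.
Proof.
move=> h; have [nw _] := cross_coside h; move: h nw; rewrite /side /coside.
case: ifP => _ h; first by move=> /negbTE ->.
by rewrite h.
Qed.

Lemma clique_nbhd_le z (A : {set T}) : clique e A -> A \subset N z -> #|A| <= lam.+1.
Proof.
move=> cA /subsetP AN; case: (posnP #|A|) => [->//|/card_gt0P[p pA]].
have zp : e z p by have := AN p pA; rewrite inE.
rewrite (cardsD1 p) pA add1n ltnS -(common_edge drg zp); apply: subset_leq_card.
apply/subsetP => t; rewrite !inE => /andP[tp tA]; have := AN t tA; rewrite inE => -> /=.
by apply: cA => //; rewrite eq_sym.
Qed.

Lemma side_big z y : k <= lam.+1 + #|side z y|.
Proof.
rewrite -(card_nbhd drg z) -(sideU z y) addnC; apply: leq_trans (leq_card_setU _ _) _.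
rewrite leq_add2l; apply: (@clique_nbhd_le z); first exact: coside_clique.
by rewrite -(sideU z y) subsetUr.
Qed.

Lemma line_sub z y : e z y -> line z y \subset line y z.
Proof.
move=> zy; have yz : e y z by rewrite es.
apply/subsetP => p; rewrite in_setU1 => /orP[/eqP->|pz].
  by rewrite in_setU1 mem_side ?orbT.
have [->|py] := eqVneq p y; first by rewrite in_setU1 eqxx.
have yA := mem_side zy; have zS := mem_side yz.
rewrite in_setU1 (negbTE py) /=; apply/negPn/negP => pS.
have ep : e y p by apply: side_clique yA pz _; rewrite eq_sym.
have pS' : p \in coside y z.
  by have : p \in N y; [rewrite inE|rewrite -(sideU y z) in_setU (negbTE pS)].
have [_ h1] := cross_coside pS'; have [_ h2] := cross_side zS.
have : #|side z y| <= 1 + (#|side y z :&: N p| + #|coside y z :&: N z|).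
  rewrite (cardsD1 y) yA leq_add2l.
  apply: leq_trans _ (leq_card_setU _ _); apply: subset_leq_card; apply/subsetP => t.
  rewrite in_setD1 => /andP[ty tA].
  have : t \in N y by rewrite inE; apply: side_clique yA tA _; rewrite eq_sym.
  rewrite -(sideU y z) in_setU [in X in _ -> X]in_setU !in_setI => /orP[tS|tS]; rewrite tS /=.
    have tp : p != t by apply: contraNneq pS => ->.
    by rewrite inE (side_clique pz tA tp).
  by rewrite [_ \in N z]inE (side_sub tA) orbT.
have := side_big z y; have := lam_half drg d3; have := mu_gt0 drg d3; lia.
Qed.

Lemma lineC z y : e z y -> line z y = line y z.
Proof. by move=> zy; apply/eqP; rewrite eqEsubset !line_sub // es. Qed.

Lemma line_l z y : z \in line z y. Proof. exact: setU11. Qed.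
Lemma line_r z y : e z y -> y \in line z y. Proof. by move=> zy; rewrite in_setU1 mem_side ?orbT. Qed.

Lemma line_clique z y : clique e (line z y).
Proof.
move=> a b; rewrite !in_setU1 => /orP[/eqP->|az] /orP[/eqP->|bz] ab; rewrite ?eqxx // in ab *.
- exact: side_sub bz.
- by rewrite es; exact: side_sub az.
exact: side_clique az bz ab.
Qed.

Lemma line_from z y w : w \in line z y -> w != z -> line z w = line z y.
Proof. by rewrite in_setU1 => /orP[/eqP->|h]; rewrite ?eqxx // /line (side_eq h). Qed.

Lemma line_eq z y a b : e z y -> a \in line z y -> b \in line z y -> a != b -> line a b = line z y.
Proof.
move=> zy al bl ab; have [az|az] := eqVneq a z.
  by rewrite az; apply: line_from; rewrite // eq_sym -az.
have za : e z a by apply: (line_clique (line_l z y) al); rewrite eq_sym.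
have l1 : line a z = line z y by rewrite -(lineC za) (line_from al).
by rewrite -l1; apply: line_from; rewrite ?l1 // eq_sym.
Qed.

Lemma coside_nonempty z y : e z y -> exists w, w \in coside z y.
Proof.
move=> zy; have yz : y \in N z by rewrite inE.
have /card_gt0P[s] := nonnbrs_gt0 drg d3 yz; rewrite inE => /and3P[sz sy nys].
exists s; move: sz; rewrite -(sideU z y) in_setU => /orP[sS|//].
by case/negP: nys; apply: (side_clique (mem_side zy) sS); rewrite eq_sym.
Qed.

Lemma two_lines z y1 y2 w : e z y1 -> e z y2 -> line z y1 != line z y2 -> e z w ->
  line z w = line z y1 \/ line z w = line z y2.
Proof.
move=> h1 h2 ne zw.
have wN : w \in N z by rewrite inE.
have y2c : y2 \in coside z y1.
  have : y2 \in N z by rewrite inE.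
  rewrite -(sideU z y1) in_setU => /orP[h|//].
  by rewrite /line (side_eq h) eqxx in ne.
move: wN; rewrite -(sideU z y1) in_setU => /orP[h|h]; [left|right].
  by rewrite /line (side_eq h).
by rewrite /line (coside_eq h) (coside_eq y2c).
Qed.

Lemma card_two_lines z y1 y2 : e z y1 -> e z y2 -> line z y1 != line z y2 ->
  #|line z y1| + #|line z y2| = k.+2.
Proof.
move=> h1 h2 ne.
have y2c : y2 \in coside z y1.
  have : y2 \in N z by rewrite inE.
  rewrite -(sideU z y1) in_setU => /orP[h|//].
  by rewrite /line (side_eq h) eqxx in ne.
have zn w : z \notin side z w by apply/negP => /side_sub; rewrite ei.
rewrite /line !cardsU1 !zn (coside_eq y2c) -(card_nbhd drg z) -(sideU z y1).
have := cardsUI (side z y1) (coside z y1).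
have -> : side z y1 :&: coside z y1 = set0.
  apply/setP => t; rewrite in_set0 in_setI; apply/negP => /andP[tS tC].
  by have [/negP[]] := cross_side tS.
rewrite cards0; lia.
Qed.

Lemma line_le z y : e z y -> #|line z y| <= lam.+2.
Proof.
move=> zy; have zn : z \notin side z y by apply/negP => /side_sub; rewrite ei.
rewrite /line cardsU1 zn add1n ltnS; apply: (@clique_nbhd_le z); first exact: side_clique.
by rewrite -(sideU z y) subsetUl.
Qed.

Lemma line_common z y a b : e z y -> a \in line z y -> b \in line z y -> a != b ->
  line z y :\: [set a; b] \subset N a :&: N b.
Proof.
move=> zy al bl ab; apply/subsetP => t; rewrite !inE negb_or -!andbA => /and3P[ta tb tl].
have {}tl : t \in line z y by rewrite in_setU1.
by rewrite !(@line_clique z y) // eq_sym.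
Qed.

Lemma card_line_common z y a b : a \in line z y -> b \in line z y -> a != b ->
  #|line z y :\: [set a; b]| + 2 = #|line z y|.
Proof.
move=> al bl ab; have <- : #|[set a; b]| = 2 by rewrite cards2 ab.
rewrite addnC -(cardsID [set a; b] (line z y)); congr (_ + _); apply: eq_card => t.
by rewrite in_setI; case: (boolP (t \in [set a; b])); rewrite ?andbF // !inE => /orP[] /eqP->; rewrite andbT -in_setU1.
Qed.

(* As dist z w = 3, the line through x and w misses the neighbourhood of z. *)
Section Far.
Variables z x w : T.
Hypotheses (dzx : dist z x = 2) (dzw : dist z w = 3) (xw : e x w).
Notation far := (line x w).

Lemma far_dist p : p \in far -> 2 <= dist z p <= 3.
Proof.
move=> pl; have px : p = x \/ e x p.
  by have [|px] := eqVneq p x; [left|right; apply: (line_clique (line_l x w) pl); rewrite eq_sym].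
have pw : p = w \/ e w p.
  by have [|pw] := eqVneq p w; [left|right; apply: (line_clique (line_r xw) pl); rewrite eq_sym].
case: px => [->|px]; first by rewrite dzx.
case: pw => [->|pw]; first by rewrite dzw.
have [] := dist_adj es ec z px; have [] := dist_adj es ec z pw; lia.
Qed.

Lemma far_mid : exists2 y, e z y & e x y.
Proof. by case: (dist_pred ec dzx) => y /eqP; rewrite (dist_eq1 ei ec) es => zy yx; exists y; rewrite // es. Qed.

Lemma far_line y : e z y -> e x y -> line x y != far.
Proof.
move=> zy xy; apply/eqP => E; have : y \in far by rewrite -E line_r.
by move/far_dist; rewrite (dist1 ei ec zy).
Qed.

Lemma xz_neq : x != z. Proof. by apply/eqP => E; move: dzx; rewrite E (distxx ec). Qed.
Lemma xz_nadj : ~~ e x z. Proof. by rewrite -(dist_eq1 ei ec) dC dzx. Qed.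

Lemma mid_line y v : e z y -> e x y -> e z v -> e x v -> line x v = line x y.
Proof.
move=> zy xy zv xv.
case: (two_lines xy xw (far_line zy xy) xv) => // E.
by have := far_line zv xv; rewrite E eqxx.
Qed.

(** A common neighbour [c] of [x] and [y] off their line would lie on the second line at [x], which
    is [far], and on the second line at [y], which contains [z]; but no point of [far] is equal or
    adjacent to [z]. *)
Lemma mid_card y : e z y -> e x y -> lam.+2 <= #|line x y|.
Proof.
move=> zy xy; have l1 := line_l x y; have l2 := line_r xy; have ne := edge_neq drg xy.
rewrite -(card_line_common l1 l2 ne) addn2 !ltnS -(common_edge drg xy).
apply: subset_leq_card; apply/subsetP => c; rewrite !inE => /andP[xc yc].
have cx : c != x by rewrite eq_sym (edge_neq drg xc).
have cy : c != y by rewrite eq_sym (edge_neq drg yc).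
rewrite (negbTE cx) (negbTE cy) /= .
case: (two_lines xy xw (far_line zy xy) xc) => E.
  by have := line_r xc; rewrite E in_setU1 (negbTE cx).
have cf : c \in far by rewrite -E line_r.
have yz : e y z by rewrite es.
have yx : e y x by rewrite es.
have ne2 : line y x != line y z.
  apply/eqP => E2; case/negP: xz_nadj; apply: (@line_clique y x); last exact: xz_neq.
    exact: line_r.
  by rewrite E2 line_r.
case: (two_lines yx yz ne2 yc) => E3.
  by have := line_r yc; rewrite E3 -(lineC xy) in_setU1 (negbTE cx).
have zc : c = z \/ e z c.
  have [|cz] := eqVneq c z; [by left|right; apply: (@line_clique y z) => //].
  - exact: line_r.
  - by rewrite -E3 line_r.
  by rewrite eq_sym.
have := far_dist cf; case: zc => [->|zc]; first by rewrite (distxx ec).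
by rewrite (dist1 ei ec zc).
Qed.

(** Two common neighbours of [z] and [x] lie on one line through [x]. That line already contains
    [lam] common neighbours of the two, and [z] would be one more. *)
Lemma far_mu : mu = 1.
Proof.
have [y zy xy] := far_mid.
apply/eqP; rewrite eqn_leq (mu_gt0 drg d3) andbT leqNgt; apply/negP.
have -> : mu = nb (dist z x) 1 by rewrite dzx.
rewrite -(common_nbrsE drg) => /card_gt1P[a [b []]].
rewrite !inE => /andP[za xa] /andP[zb xb] ab.
have Lab := mid_line za xa zb xb.
have al := line_r xa; have bl : b \in line x a by rewrite -Lab line_r.
have := mid_card za xa; rewrite -(card_line_common al bl ab) addn2 !ltnS leqNgt => /negP[].
have eab := @line_clique x a a b al bl ab.
rewrite -(common_edge drg eab).
have zl : z \notin line x a.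
  by apply/negP => zl; case/negP: xz_nadj; apply: line_clique (line_l x a) zl xz_neq.
apply: proper_card; apply/properP; split; first exact: line_common.
by exists z; [rewrite !inE !(es _ z) za zb|rewrite in_setD negb_and zl orbT].
Qed.

Lemma far_mid_unique y v : e z y -> e x y -> e z v -> e x v -> v = y.
Proof.
move=> zy xy zv xv; apply/eqP/negPn/negP => vy.
have : nb (dist z x) 1 = 1 by rewrite dzx far_mu.
rewrite -(common_nbrsE drg) => h.
have : 1 < #|[set u | e z u & e x u]|.
  by apply/card_gt1P; exists v, y; rewrite !inE zy xy zv xv.
by rewrite h.
Qed.

(** A common neighbour of [y] and [z] off their line would lie on [line y x] and be a second common
    neighbour of [x] and [z]. *)
Lemma far_zcard y : e z y -> e x y -> lam.+2 <= #|line y z|.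
Proof.
move=> zy xy; have yz : e y z by rewrite es.
have yx : e y x by rewrite es.
have l1 := line_l y z; have l2 := line_r yz; have ne := edge_neq drg yz.
rewrite -(card_line_common l1 l2 ne) addn2 !ltnS -(common_edge drg yz).
apply: subset_leq_card; apply/subsetP => c; rewrite !inE => /andP[yc zc].
have cz : c != z by rewrite eq_sym (edge_neq drg zc).
have cy : c != y by rewrite eq_sym (edge_neq drg yc).
rewrite (negbTE cz) (negbTE cy) /= .
have ne2 : line y x != line y z.
  apply/eqP => E2; case/negP: xz_nadj; apply: (@line_clique y x); last exact: xz_neq.
    exact: line_r.
  by rewrite E2 line_r.
case: (two_lines yx yz ne2 yc) => E3; last first.
  by have := line_r yc; rewrite E3 in_setU1 (negbTE cy).
have xc : e x c.
  apply: (@line_clique y x); first exact: line_r.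
    by rewrite -E3 line_r.
  by apply: contraTneq zc => <-; rewrite es xz_nadj.
by have := far_mid_unique zy xy zc xc => E; rewrite E eqxx in cy.
Qed.

(** The two lines at [y] have at least [lam.+2] points each, so the valency is at least
    [2 * lam + 2]. At any point the sizes of two lines add up to [k.+2] and neither exceeds
    [lam.+2], so both attain it. *)
Lemma far_line_card a b : e a b -> #|line a b| = lam.+2.
Proof.
have [y zy xy] := far_mid; have yz : e y z by rewrite es.
have yx : e y x by rewrite es.
have ne2 : line y x != line y z.
  apply/eqP => E2; case/negP: xz_nadj; apply: (@line_clique y x); last exact: xz_neq.
    exact: line_r.
  by rewrite E2 line_r.
have := card_two_lines yx yz ne2; have := mid_card zy xy; have := far_zcard zy xy.
rewrite (lineC xy) => h1 h2 h3 ab.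
have := line_le ab.
have [c cc] := coside_nonempty ab.
have ac : e a c := coside_sub cc.
have nac : line a b != line a c.
  apply/eqP => E; have [/negP[]] := cross_coside cc.
  have : c \in line a b by rewrite E line_r.
  by rewrite in_setU1 => /orP[/eqP ca|//]; rewrite ca ei in ac.
have := card_two_lines ab ac nac; have := line_le ac; lia.
Qed.

Lemma far_triangle a b c : e a b -> e a c -> e b c -> c \in line a b.
Proof.
move=> ab ac bc; have l1 := line_l a b; have l2 := line_r ab; have ne := edge_neq drg ab.
have sub := line_common ab l1 l2 ne.
have := card_line_common l1 l2 ne; rewrite far_line_card // addn2 => -[].
rewrite -(common_edge drg ab) => E.
have EE : line a b :\: [set a; b] = N a :&: N b by apply/eqP; rewrite eqEcard sub E leqnn.
by have : c \in N a :&: N b; [rewrite !inE ac bc|rewrite -EE in_setD => /andP[]].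
Qed.

(** Triangles lie on lines, so [v = v'] or an edge from [p] to [v'] is impossible. Otherwise [p] and
    [v'] have the two common neighbours [p'] and [v], against [far_mu]. *)
Lemma far_quad p p' v v' : p \in far -> p' \in far -> p != p' -> e p v -> e p' v' ->
  v \notin far -> v' \notin far -> v = v' \/ e v v' -> False.
Proof.
move=> pl pl' pp pv pv' vn vn' vv.
have epp := line_clique pl pl' pp.
have L := line_eq xw pl pl' pp.
have no t : e p t -> e p' t -> t \notin far -> False.
  by move=> pt pt'; rewrite -L (far_triangle epp pt pt').
case: vv => [E|vv]; first by apply: (no v); rewrite // E.
case: (boolP (e p v')) => [h|h]; first exact: (no v').
have pv'n : p != v' by apply: contraNneq vn' => <-.
have : 1 < #|N p :&: N v'|.
  apply/card_gt1P; exists p', v; split.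
  - by rewrite !inE epp es.
  - by rewrite !inE pv es.
  by apply: contraNneq vn => <-.
have pp' : e p' p by rewrite es.
by rewrite (common_nonedge drg d3 pv'n h pp' pv') far_mu.
Qed.

(* The neighbours of z lie on two lines, so three points of the far line give
   two with the same hat line. *)
Lemma far_pigeonhole (W : {set T}) (hat : T -> T -> Prop) : W \subset far ->
  (forall p, p \in W -> exists2 v, e z v & hat p v) ->
  (forall p p' v v', p \in W -> p' \in W -> p != p' -> hat p v -> hat p' v' ->
     e z v -> e z v' -> v = v' \/ e v v' -> False) ->
  #|W| <= 2.
Proof.
move=> Wf hx hno; rewrite leqNgt; apply/negP => /card_gt2P[p1 [p2 [p3 [[W1 W2 W3] [n12 n23 n31]]]]].
have [v1 z1 h1] := hx _ W1; have [v2 z2 h2] := hx _ W2; have [v3 z3 h3] := hx _ W3.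
have same v v' : e z v -> e z v' -> (v \in P z) = (v' \in P z) -> v = v' \/ e v v'.
  move=> zv zv' E; have [|ne] := eqVneq v v'; [by left|right].
  case vP: (v \in P z) E => E; first by apply: (Pc vP); rewrite -?E.
  have inQ t : e z t -> t \in P z = false -> t \in Q z.
    by move=> zt tP; have : t \in N z; [rewrite inE|rewrite -PQ in_setU tP].
  by apply: (@Qc z); rewrite // inQ.
have s12 := hno _ _ _ _ W1 W2 n12 h1 h2 z1 z2.
have s23 := hno _ _ _ _ W2 W3 n23 h2 h3 z2 z3.
have s31 := hno _ _ _ _ W3 W1 n31 h3 h1 z3 z1.
case c1: (v1 \in P z); case c2: (v2 \in P z); case c3: (v3 \in P z);
 solve [by apply: s12; apply: same; rewrite // c1 c2
       |by apply: s23; apply: same; rewrite // c2 c3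
       |by apply: s31; apply: same; rewrite // c3 c1].
Qed.

(** At most two points of the line are at distance 2 from [z], by the pigeonhole with midpoints as
    hats; the other points are neighbours of [x] at distance 3 from [z]. *)
Lemma far_b2 : lam <= nb 2 3.
Proof.
pose W := [set p in far | dist z p == 2].
have W2 : #|W| <= 2.
  apply: (@far_pigeonhole W (fun p v => e p v)).
  - by apply/subsetP => p; rewrite inE => /andP[].
  - move=> p; rewrite inE => /andP[_ /eqP dp]; case: (dist_pred ec dp) => v /eqP.
    by rewrite (dist_eq1 ei ec) => zv vp; exists v; rewrite // es.
  move=> p p' v v'; rewrite !inE => /andP[pf _] /andP[pf' _] pp pv pv' zv zv' vv.
  have nf t : e z t -> t \notin far.
    by move=> zt; apply/negP => /far_dist; rewrite (dist1 ei ec zt).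
  by apply: (far_quad _ _ pp pv pv' (nf _ zv) (nf _ zv') vv); rewrite in_setU1.
have := far_line_card xw; rewrite -(cardsID [set p | dist z p == 2] far).
have -> : far :&: [set p | dist z p == 2] = W by apply/setP => p; rewrite in_setI !in_set.
have : #|far :\: [set p | dist z p == 2]| <= nb 2 3.
  have -> : nb 2 3 = nb (dist z x) 3 by rewrite dzx.
  rewrite -(nbE drg); apply: subset_leq_card; apply/subsetP => p.
  rewrite in_setD !inE => /andP[d2 pf]; have := far_dist (p := p); rewrite in_setU1 pf => /(_ isT) h.
  have d3' : dist z p = 3 by lia.
  rewrite d3' eqxx andbT; apply: (line_clique (line_l x w)); first by rewrite in_setU1 pf.
  by apply: contraNneq d2 => <-; rewrite dzx.
lia.
Qed.

End Far.
End Lines.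

(** * Antipodal graphs *)

Section Antipodal.
Variables (T : finType) (e : rel T) (d : nat).
Hypothesis drg : distance_regular e d.
Hypothesis d3 : 3 <= d.
Notation dist := (gdist e).
Notation nb := (nb e).
Notation k_ := (ksph e).
Notation k := (nb 0 1).
Notation lam := (nb 1 1).
Notation mu := (nb 2 1).
Local Notation es := (drg_sym drg).
Local Notation ei := (drg_irr drg).
Local Notation ec := (drg_conn drg).
Local Notation dC := (distC es ec).

Definition antip x y := (dist x y == 0) || (dist x y == d).
Local Notation same := antip.
Hypothesis same_trans : transitive same.

Lemma same_refl x : same x x. Proof. by rewrite /same (distxx ec). Qed.
Lemma same_sym x y : same x y = same y x. Proof. by rewrite /same dC. Qed.

Lemma same_close x y : same x y -> dist x y < d -> x = y.
Proof. by rewrite /same (dist_eq0 ec) => /orP[/eqP//|/eqP->]; rewrite ltnn. Qed.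

Definition fibre x := [set y | same x y].
Definition fsize := (k_ d).+1.

Lemma card_fibre x : #|fibre x| = fsize.
Proof.
rewrite (cardsD1 x) inE same_refl /fsize add1n -(ksphE drg d x); congr _.+1.
apply: eq_card => y; rewrite !inE /same (dist_eq0 ec) (eq_sym x).
by have [->|] := eqVneq y x; rewrite //= (distxx ec); apply/esym/negbTE; rewrite neq_ltn; lia.
Qed.

Lemma fsize_ge2 : 2 <= fsize. Proof. by rewrite ltnS (ksph_gt0 drg). Qed.

(** A geodesic from [x'] to [w] extends to a vertex of the same fibre at distance [d]; as [w] is
    close to [x], this vertex can only be [x]. *)
Lemma antipode_far w x x' : same x x' -> x != x' -> 2 * dist w x < d -> dist w x' = d - dist w x.
Proof.
move=> sx xx' lt; have dxx : dist x x' = d.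
  by move: sx; rewrite /same (dist_eq0 ec) (negbTE xx') => /eqP.
have := dist_tri ec x w x'; rewrite dxx (dC x w) => ge.
have le := le_diam drg w x'.
have [|z dz dwz] := @extend_to _ _ _ drg x' w d; first by rewrite dC le leqnn.
have : same x z by apply: (same_trans sx); rewrite /same dz eqxx orbT.
rewrite /same (dist_eq0 ec) => /orP[/eqP E|/eqP E]; first by move: dwz; rewrite -E (dC x'); lia.
have := dist_tri ec x w z; rewrite E dwz (dC x w) (dC x' w); lia.
Qed.

Lemma near_ex w x : exists2 x', same x x' & dist w x' = minn (dist w x) (d - dist w x).
Proof.
have [h|h] := leqP (dist w x) (d - dist w x).
  by exists x; [exact: same_refl|lia].
have [|z dz dwz] := @extend_to _ _ _ drg x w d; first by rewrite (le_diam drg) leqnn.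
by exists z; [rewrite /same dz eqxx orbT|rewrite dwz (dC x w); lia].
Qed.

(* The distance between the fibres of w and x in the folded graph. *)
Definition fdist w x := minn (dist w x) (d - dist w x).
Local Notation fd := fdist.

Lemma fd_sym w x : fd w x = fd x w. Proof. by rewrite /fd dC. Qed.

Lemma fd_le w x : 2 * fd w x <= d.
Proof. by rewrite /fd; have := le_diam drg w x; lia. Qed.

Lemma fd_same_le w x x' : same x x' -> fd w x' <= fd w x.
Proof.
move=> sx; have [z sz dz] := near_ex w x; rewrite [in X in _ <= X]/fd -dz.
have le2 : 2 * dist w z <= d by rewrite dz; exact: fd_le.
have szx : same z x' by apply: (@same_trans x); rewrite // same_sym.
have [<-|zx] := eqVneq z x'; first by rewrite /fd geq_minl.
have [lt|ge] := ltnP (2 * dist w z) d; last by have := fd_le w x'; lia.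
by rewrite /fd (antipode_far szx zx lt) geq_min leq_subLR; apply/orP; right; lia.
Qed.

Lemma fd_same w x x' : same x x' -> fd w x = fd w x'.
Proof. by move=> sx; apply/eqP; rewrite eqn_leq !fd_same_le // same_sym. Qed.

Lemma near w x : exists2 x', same x x' & dist w x' = fd w x.
Proof. exact: near_ex. Qed.

Lemma lift_edge x y x' : e x y -> same x x' -> exists2 y', same y y' & e x' y'.
Proof.
move=> xy sx; have [y' sy dy] := near x' y; exists y' => //.
rewrite -(dist_eq1 ei ec) dy fd_sym -(fd_same y sx) fd_sym.
by apply/eqP; rewrite /fd (dist1 ei ec xy); lia.
Qed.

Lemma card_fibres (S B : {set T}) : {in S &, forall x y, same x y -> x = y} ->
  (forall x, x \in S -> fibre x \subset B) -> #|S| * fsize <= #|B|.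
Proof.
move=> Si SB; rewrite -[#|B|]muln1; apply: (@double_count_le _ _ _ same) => [a aS|b bB].
  rewrite -(card_fibre a); apply: subset_leq_card; apply/subsetP => y ya.
  by rewrite inE (subsetP (SB a aS)) //; rewrite inE in ya.
apply/card_le1_eqP => x y; rewrite !inE => /andP[xS xb] /andP[yS yb].
by apply/esym/Si => //; rewrite (same_sym y) in yb; apply: (same_trans xb yb).
Qed.

Lemma sphere_fibres i : 2 * i < d -> k_ i * fsize <= #|T|.
Proof.
move=> id; have [x _] := dist_exists drg (leq0n d).
rewrite -(ksphE drg i x) -cardsT; apply: card_fibres => [y z|y _]; last exact: subsetT.
rewrite !inE => /eqP dy /eqP dz syz; apply: same_close syz _.
have := dist_tri ec y x z; rewrite (dC y x); lia.
Qed.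

Lemma ball1_fibres : k.+1 * fsize <= #|T|.
Proof.
have [x _] := dist_exists drg (leq0n d).
have -> : k.+1 = #|x |: [set w | e x w]|.
  by rewrite cardsU1 inE ei (valencyE drg).
rewrite -cardsT; apply: card_fibres => [y z|y _]; last exact: subsetT.
have h w : w \in x |: [set w | e x w] -> dist x w <= 1.
  by rewrite !inE => /orP[/eqP->|/(dist1 ei ec)->]; rewrite ?(distxx ec).
move=> /h dy /h dz syz; apply: same_close syz _.
have := dist_tri ec y x z; rewrite (dC y x); lia.
Qed.

(** Let [z] be at distance [d.-1] from [x] and [z'] be the member of its fibre adjacent to [x]: a
    neighbour of [x] at distance 2 from [z'] is at distance [d.-2] from [z]. For [d = 4] this is the
    midpoint, handled through [fd_same]. *)
Lemma c_last : 4 <= d -> nb 1 2 <= nb d.-1 d.-2.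
Proof.
move=> d4; have [|z [x dzx]] := @dist_exists _ _ _ drg d.-1; first lia.
have [z' sz dz'] := near x z.
have {}dz' : dist z' x = 1 by rewrite dC dz' /fd dC dzx; lia.
have zz : z != z' by apply/eqP => E; move: dzx; rewrite E dz'; lia.
rewrite -[X in nb X 2]dz' -dzx -!(nbE drg); apply: subset_leq_card; apply/subsetP => y.
rewrite !inE => /andP[xy /eqP dy]; rewrite xy /=; apply/eqP.
have [h|h] := ltnP (2 * 2) d.
  rewrite same_sym in sz; rewrite eq_sym in zz.
  have := @antipode_far y z' z sz zz; rewrite !(dC y) dy => /(_ h) ->; lia.
have dE : d = 4 by lia.
have := fd_same y sz; rewrite /fd !(dC y) dy; have := le_diam drg z y; rewrite dE; lia.
Qed.

Lemma k_last_le : 4 <= d -> k_ d.-1 <= k_ d.-2.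
Proof.
move=> d4; have := layer_edges drg d.-2 d.-1.
have b0 : 0 < nb d.-2 d.-1 by have := b_gt0 drg (i := d.-2); rewrite (_ : d.-2.+1 = d.-1); [apply|]; lia.
have : nb d.-2 d.-1 <= nb d.-1 d.-2.
  apply: leq_trans (c_last d4); have := @b_mono _ _ _ drg 1 d.-2.
  by rewrite (_ : d.-2.+1 = d.-1); [apply|]; lia.
move=> h E; rewrite -(leq_pmul2r b0) E leq_mul2l h orbT //.
Qed.

(** * Small motion in antipodal graphs of diameter 3, 4 and 5 *)

Section Motion.
Variable s : {perm T}.
Hypotheses (sA : graph_aut e s) (s1 : s != 1%g).
Notation M := (moved s).

Lemma same_aut x y : same (s x) (s y) = same x y.
Proof. by rewrite /same (aut_dist ec). Qed.

Lemma fixed_nbrs_max u : s u != u ->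
  #|[set w | e u w & w \notin M]| <= maxn lam mu.
Proof.
move=> um; apply: leq_trans (fixed_nbrs drg u sA) _.
have := le_diam drg u (s u); have : dist u (s u) != 0 by rewrite (dist_eq0 ec) eq_sym.
case: (dist u (s u)) => [|[|[|i]]] //= _ id; rewrite ?leq_maxl ?leq_maxr //.
by rewrite (nb_far drg).
Qed.

Notation Delta := (d.+1 * #|M|).
Hypothesis Dsmall : forall x y, #|Dset e x y| <= Delta.
Hypothesis d5 : d <= 5.
Hypothesis big : 2000 * Delta < #|T|.
Variable u0 : T.
Hypotheses (u0m : s u0 != u0) (u0d : ~~ same u0 (s u0)).

Lemma u0M : u0 \in M. Proof. by rewrite inE. Qed.

Lemma Delta_pos : 0 < Delta.
Proof. by rewrite muln_gt0 /=; apply/card_gt0P; exists u0; exact: u0M. Qed.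

Lemma M_le_Delta : #|M| <= Delta. Proof. by rewrite leq_pmull. Qed.

Lemma sum_two i j : i != j -> k_ i + k_ j <= #|T|.
Proof.
move=> ij; have [x _] := dist_exists drg (leq0n d).
have dis : [disjoint [set w | dist x w == i] & [set w | dist x w == j]].
  apply/pred0P => w /=; rewrite !inE; apply/negP => /andP[/eqP h1 /eqP h2].
  by case/eqP: ij; rewrite -h1 -h2.
by rewrite -!(ksphE drg _ x) -cardsUI (disjoint_setI0 dis) cards0 addn0 max_card.
Qed.

Definition mainlayer := if d == 5 then 3 else 2.

(** By elimination: spheres of radius below [d/2] meet each fibre at most once, [k_ d] is below
    [fsize], and [k_ d.-1] is at most [k_ d.-2] for [d >= 4]. So every layer but one holds at most
    half of the graph. *)
Lemma main_layer : #|T| <= k_ mainlayer + Delta.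
Proof.
have T0 : 0 < #|[set: T]| by rewrite cardsT; lia.
have [w _] := @concentration _ _ _ drg setT setT u0 Delta T0 (leqnn _) (fun y _ => Dsmall u0 y).
rewrite cardsT; set a := dist w u0 => conc; have {conc} ha : #|T| <= k_ a + Delta by [].
have ad : a <= d := le_diam drg w u0.
have r2 := fsize_ge2; have D0 := Delta_pos.
have low i : 2 * i < d -> 2 * k_ i <= #|T|.
  move=> id; apply: leq_trans (sphere_fibres id); rewrite mulnC leq_mul2l r2 orbT //.
have k0 : 2 * k_ 0 <= #|T| by apply: low; lia.
have k1 : 2 * k_ 1 <= #|T| by apply: low; lia.
have k2 : 5 <= d -> 2 * k_ 2 <= #|T| by move=> h; apply: low; lia.
have kd : 2 * k_ d <= #|T|.
  have := ball1_fibres; have : 0 < k by apply: (b_gt0 drg); lia.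
  have : k_ d <= fsize by []. by rewrite /fsize; nia.
have kd1 : 4 <= d -> 2 * k_ d.-1 <= #|T|.
  move=> d4; have ne : d.-1 != d.-2 by lia.
  by have := k_last_le d4; have := sum_two ne; lia.
rewrite /mainlayer; have : d = 3 \/ d = 4 \/ d = 5 by lia.
move: big D0 ha; move: (d.+1 * _) => Dl big0 D0 ha.
case=> [dE|[dE|dE]]; rewrite dE in ad kd kd1 k2 *.
- have -> : (if 3 == 5 then 3 else 2) = 2 by [].
  by case: (a) ad ha => [|[|[|[|a']]]] ad ha; lia.
- have -> : (if 4 == 5 then 3 else 2) = 2 by [].
  have k3 : 2 * k_ 3 <= #|T| := kd1 isT.
  by case: (a) ad ha => [|[|[|[|[|a']]]]] ad ha; lia.
have -> : (if 5 == 5 then 3 else 2) = 3 by [].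
have k4 : 2 * k_ 4 <= #|T| := kd1 isT.
have {}k2 : 2 * k_ 2 <= #|T| := k2 isT.
by case: (a) ad ha => [|[|[|[|[|[|a']]]]]] ad ha; lia.
Qed.

Lemma main_le : mainlayer < d.
Proof. by rewrite /mainlayer; case: eqP => [->|] //; lia. Qed.

Lemma other_layer i : i != mainlayer -> k_ i <= Delta.
Proof. by move=> im; have := sum_two im; have := main_layer; lia. Qed.

Lemma main_big : 1000 * Delta <= k_ mainlayer.
Proof. by have := main_layer; lia. Qed.

Lemma main_c : 1000 * nb mainlayer mainlayer.-1 <= k.
Proof.
have D0 := Delta_pos; have m0 : 0 < mainlayer by rewrite /mainlayer; case: ifP.
rewrite -(leq_pmul2l D0) mulnA [Delta * 1000]mulnC.
apply: leq_trans (leq_mul main_big (leqnn _)) _; rewrite (layer_edges drg).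
apply: leq_mul; first by apply: other_layer; rewrite neq_ltn; lia.
by apply: (nb_le_valency drg); have := main_le; lia.
Qed.

Lemma main_b : 1000 * nb mainlayer mainlayer.+1 <= k.
Proof.
have D0 := Delta_pos.
rewrite -(leq_pmul2l D0) mulnA [Delta * 1000]mulnC.
apply: leq_trans (leq_mul main_big (leqnn _)) _; rewrite (layer_edges drg).
apply: leq_mul; first by apply: other_layer; rewrite neq_ltn; lia.
by apply: (nb_le_valency drg); have := main_le; lia.
Qed.

Lemma mu_main : 1000 * mu <= k.
Proof.
apply: leq_trans main_c; rewrite leq_mul2l /=.
have := @c_mono _ _ _ drg 1 mainlayer.-1; have := main_le.
by rewrite /mainlayer; case: (d == 5) => /= h; apply; lia.
Qed.

Lemma two_lam_main : 2 * lam <= k + mu.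
Proof. exact: lam_half drg d3. Qed.

(* A vertex outside a moved fibre U of an antipodal cover of a complete graph
   has exactly one neighbour in U. *)
Lemma antipodal3 : d = 3 -> False.
Proof.
(* A fixed vertex in the fibre of [u0] would make [s] preserve that fibre. *)
move=> dE; have U u : u \in fibre u0 -> s u != u.
  rewrite inE => su; apply: contra u0d => /eqP h.
  by apply: (same_trans su); rewrite -{1}h same_aut same_sym.
have := @double_count_le _ (~: M) (fibre u0) e 1 (maxn lam mu).
rewrite card_fibre muln1 => h; have {h} : #|~: M| <= fsize * maxn lam mu.
  apply: h => [w wM|u uU]; last first.
    by apply: leq_trans (fixed_nbrs_max (U u uU)); apply: subset_leq_card; apply/subsetP => w; rewrite !inE (es w) andbC.
  apply/card_gt0P; have [u su du] := near w u0; exists u; rewrite !inE su /=.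
  have : fd w u0 != 0.
    rewrite -du (dist_eq0 ec); apply: contraTneq wM => ->; rewrite !inE negbK; apply: U; by rewrite inE.
  by rewrite -(dist_eq1 ei ec) du; have := fd_le w u0; rewrite dE; lia.
(* The order is at least [fsize * k.+1], while the fixed vertices number at most
   [fsize * maxn lam mu], about half of this. *)
have B1 : fsize * k + fsize <= #|T| by rewrite -mulnSr mulnC; exact: ball1_fibres.
have C : #|M| + #|~: M| = #|T| by rewrite cardsC.
have MD := M_le_Delta; have h1 := mu_main; have h2 := two_lam_main; have r2 := fsize_ge2.
have q : 2 * maxn lam mu <= k + mu by lia.
have qf : fsize * (2 * maxn lam mu) <= fsize * (k + mu) by rewrite leq_mul2l q orbT.
have hf : fsize * (1000 * mu) <= fsize * k by rewrite leq_mul2l h1 orbT.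
by rewrite mulnDr in qf; move: big; lia.
Qed.

Hypothesis d4 : 4 <= d.

(* Otherwise a walk of length 2, taken in the folded graph when d = 5, stays
   among the moved vertices often enough to reach a large part of the graph. *)
Lemma lam_large : 2 * k < 5 * lam.
Proof.
rewrite ltnNge; apply/negP => lamS.
have mu0 := mu_gt0 drg d3; have mum := mu_main; have D0 := Delta_pos.
have b1 : nb 1 2 + lam + 1 = k.
  have := nb_sum drg (i := 1); rewrite /= (leq_trans _ d3) // => /(_ isT).
  have -> : nb 1 0 = 1; last lia.
  have := layer_edges drg 0 1; rewrite (ksph0 drg) mul1n (ksph1 drg) => h.
  by apply/eqP; rewrite -(@eqn_pmul2l k) ?muln1 -?h //; lia.
(* With [lam] at most 2k/5 the number [nb 1 2] is at least 3k/5 - 1, and 10 times 2/5 is below 9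
   times 3/5. *)
have qb i : i < 2 -> 10 * maxn lam mu <= 9 * nb i i.+1.
  by case: i => [|[|]] // _; lia.
have d2 : 2 <= d by lia.
have [dE|dn] := eqVneq d 5; last first.
  have := walk drg u0M d2 (fun u uM => @fixed_nbrs_max u ltac:(by rewrite inE in uM)) qb.
  have : #|[set w in M | dist u0 w == 2]| <= Delta.
    apply: leq_trans M_le_Delta; apply: subset_leq_card.
    by apply/subsetP => w; rewrite inE => /andP[].
  have := main_big; rewrite /mainlayer (negbTE dn); lia.
(* For [d = 5] the main layer is 3. The walk of length 2 therefore runs over vertices whose fibre is
   moved: each one reached contributes a whole fibre of moved vertices, and [k_ 3] is at most
   [fsize * k_ 2]. *)
pose M' := [set u | ~~ same u (s u)].
have M'M : M' \subset M.
  by apply/subsetP => u; rewrite !inE; apply: contra => /eqP->; exact: same_refl.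
have u0M' : u0 \in M' by rewrite inE.
have fixM' u : u \in M' -> #|[set w | e u w & w \notin M']| <= maxn lam mu.
  rewrite inE => um; have [u' su du] := near u (s u).
  have ud : dist u u' <= 2 by have := fd_le u (s u); rewrite du dE; lia.
  have un : dist u u' != 0.
    by rewrite (dist_eq0 ec); apply: contraNneq um => uE; rewrite {1}uE same_sym.
  apply: (@leq_trans (nb (dist u u') 1)); last first.
    by case: (dist u u') ud un => [|[|[|]]] //= _ _; rewrite ?leq_maxl ?leq_maxr.
  rewrite -(common_nbrsE drg); apply: subset_leq_card; apply/subsetP => w.
  rewrite !inE negbK => /andP[uw sw]; rewrite uw /=.
  have suw : e (s u) (s w) by rewrite sA.
  have [w' sw' uw'] := lift_edge suw su.
  have E : w = w'.
    apply: same_close (same_trans sw sw') _.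
    apply: leq_ltn_trans (dist_tri ec w u w') _.
    apply: leq_ltn_trans (leq_add (leqnn _) (dist_tri ec u u' w')) _.
    rewrite (dist1 ei ec uw') (dC w u) (dist1 ei ec uw) dE.
    by move: ud; clear; lia.
  by rewrite E.
have := walk drg u0M' d2 fixM' qb; set W := [set w in M' | _] => h.
have hW : #|W| * fsize <= #|M|.
  apply: card_fibres => [x y|x].
    rewrite !inE => /andP[_ /eqP dx] /andP[_ /eqP dy] sxy; apply: same_close sxy _.
    have := dist_tri ec x u0 y; rewrite (dC x u0) dx dy dE; lia.
  rewrite !inE => /andP[xM _]; apply: subset_trans M'M; apply/subsetP => y; rewrite !inE => sxy.
  apply: contra xM => syy; have syx : same (s y) (s x) by rewrite same_aut same_sym.
  exact: same_trans sxy (same_trans syy syx).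
have k32 : k_ 3 * 1 <= fsize * k_ 2.
  rewrite -(ksphE drg 3 u0) -(card_fibre u0).
  apply: (@double_count_le _ _ _ (fun y x => dist x y == 2)) => [y|x _].
    rewrite inE => /eqP dy; apply/card_gt0P; have [x sx dx] := near y u0.
    by exists x; rewrite !inE sx /= dC dx /fd dC dy dE.
  by rewrite -(ksphE drg 2 x); apply: subset_leq_card; apply/subsetP => y; rewrite !inE => /andP[].
have := main_big; have := M_le_Delta; rewrite /mainlayer dE eqxx.
have : fsize * k_ 2 <= fsize * (10 ^ 2 * #|W|) by rewrite leq_mul2l h orbT.
lia.
Qed.

Lemma antipodal45 : False.
Proof.
have mum := mu_main; have lamL := lam_large.
have [f fP] := @fin_all_exists _ _ _ (two_cliques drg d3 mum lamL).
pose P z := (f z).1; pose Q z := (f z).2.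
have PQ z : P z :|: Q z = nbhd e z by case: (fP z).
have Pc z : clique e (P z) by case: (fP z).
have Qc z : clique e (Q z) by case: (fP z).
have [z [w dzw]] := dist_exists drg d3.
case: (dist_pred ec dzw) => x dzx xw.
have lamle := far_b2 drg d3 mum lamL PQ Pc Qc dzx dzw xw.
have mu0 := mu_gt0 drg d3.
(* For [d = 4] the main layer is 2, so [nb 2 3] is tiny, against [lamle]. For [d = 5] the main layer
   is 3 and [nb 2 3] may be large. *)
have [dE|dn] := eqVneq d 5; last first.
  by have := main_b; rewrite /mainlayer (negbTE dn); lia.
have fl := far_dist drg d3 mum lamL PQ Pc Qc dzx dzw xw.
set far := line P Q x w in fl.
have farx p : p \in far -> dist x p <= 1.
  move=> pf; have [->|xp] := eqVneq x p; first by rewrite (distxx ec).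
  by rewrite (dist1 ei ec) //; apply: (line_clique drg PQ Pc Qc (line_l _ _ _ _) pf xp).
have far2 z' p : same z z' -> p \in far -> 2 <= dist z' p.
  move=> sz pf; rewrite leqNgt; apply/negP => lt.
  have E : z = z'.
    apply: same_close sz _; have := dist_tri ec z x z'; have := dist_tri ec x p z'.
    by rewrite (dC p z'); have := farx p pf; rewrite dzx dE; lia.
  by have := fl p pf; rewrite E; lia.
(* Each point of the line is at distance 2 from some vertex in the fibre of [z]; the midpoint is
   carried along its fibre to a neighbour of [z]. Now all points of the line have hats, so it has at
   most two points. *)
pose hat p v := exists v' z', [/\ same z z', e z' v', e p v' & same v' v].
have : #|far| <= 2.
  apply: (far_pigeonhole PQ Pc Qc (z := z) (x := x) (w := w) (hat := hat)) => //.
    move=> p pf; have [z' sz dz] := near p z.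
    have {}dz : dist z' p = 2.
      by have := far2 z' p sz pf; have := fd_le p z; rewrite (dC z') dz dE; lia.
    case: (dist_pred ec dz) => v' /eqP; rewrite (dist_eq1 ei ec) => zv vp.
    rewrite same_sym in sz; have [v sv zv'] := lift_edge zv sz.
    by exists v => //; exists v', z'; split => //; rewrite // ?(same_sym z) // es.
  move=> p p' v1 v2 pf pf' pp [v [z1 [sz1 zv pv sv]]] [v' [z2 [sz2 zv' pv' sv']]] _ _ v12.
  have nf t z' : same z z' -> e z' t -> t \notin far.
    by move=> sz zt; apply/negP => /(far2 _ _ sz); rewrite (dist1 ei ec zt).
  apply: (far_quad drg d3 mum lamL PQ Pc Qc dzx dzw xw pf pf' pp pv pv' (nf _ _ sz1 zv) (nf _ _ sz2 zv')).
  have [v'' sv'' vv] : exists2 v'', same v'' v' & v = v'' \/ e v v''.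
    case: v12 => [E|E].
      by exists v; [rewrite -E same_sym in sv'; apply: same_trans sv sv'|left].
    have svv : same v1 v by rewrite same_sym.
    have [v'' s2 vv] := lift_edge E svv; exists v''; last by right.
    by rewrite same_sym in s2; rewrite same_sym in sv'; apply: same_trans s2 sv'.
  have vd : dist v v'' <= 1 by case: vv => [<-|/(dist1 ei ec)->]; rewrite ?(distxx ec).
  suff <- : v'' = v' by [].
  apply: same_close sv'' _.
  have epp := line_clique drg PQ Pc Qc pf pf' pp.
  have := dist_tri ec v'' v v'; have := dist_tri ec v p v'; have := dist_tri ec p p' v'.
  rewrite (dist1 ei ec pv') (dC v p) (dist1 ei ec pv) (dist1 ei ec epp) (dC v'' v) dE; move: vd; clear; lia.
have := far_line_card drg d3 mum lamL PQ Pc Qc dzx dzw xw xw; rewrite -/far; lia.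
Qed.

End Motion.
End Antipodal.

Lemma antipodal_small_motion (T : finType) (e : rel T) d (s : {perm T}) :
  distance_regular e d -> 3 <= d <= 5 -> ~ parity_graph e -> transitive (antip e d) ->
  3 <= nb e 0 1 -> graph_aut e s -> s != 1%g ->
  #|T| <= 2000 * d.+1 * #|moved s|.
Proof.
move=> drg /andP[d3 d5] npg st k3 sA s1; rewrite -mulnA leqNgt; apply/negP => big.
have [/existsP[u /andP[um ud]]|nu] := boolP [exists u, (s u != u) && (gdist e u (s u) < 3)]; last first.
  move: big; rewrite (moved_all drg d3 sA s1) ?cardsT => [|u um].
    by rewrite mulnA ltnNge leq_pmull // muln_gt0.
  by rewrite leqNgt; apply: contra nu => lt; apply/existsP; exists u; rewrite um.
have u0 : gdist e u (s u) != 0 by rewrite (dist_eq0 (drg_conn drg)) eq_sym.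
have Dsmall x y : #|Dset e x y| <= d.+1 * #|moved s|.
  apply: (Dset_connect drg (erefl _) (Dset_moved drg u sA)).
  have [|c|[h _]|[h _ _]] := @smith _ _ _ drg d3 (gdist e u (s u)) k3; first by lia.
  - exact: c.
  - by lia.
  by [].
have nsame : ~~ antip e d u (s u) by rewrite /antip (negbTE u0) neq_ltn (leq_trans ud).
have [d4|d4] := leqP 4 d.
  exact: (antipodal45 drg d3 st sA s1 Dsmall d5 big um nsame d4).
by apply: (antipodal3 drg d3 st sA s1 Dsmall d5 big um nsame); lia.
Qed.

Lemma drg_intro (T : finType) (e : rel T) d : simple_graph e -> gconnected e ->
  has_diameter e d -> (forall j, dinv e (nbrs e j)) -> distance_regular e d.
Proof.
move=> sg gc hd inv; split=> //.
exists (fun i => dval e (nbrs e i.-1) i), (fun i => dval e (nbrs e i) i), (fun i => dval e (nbrs e i.+1) i).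
by move=> v w i; split; rewrite -(dvalE _ _ (inv _)).
Qed.

(** * Folded graphs *)

(** With [t] the diameter, this and [closer_even] link the descents towards [u] locally. Hamming and
    Johnson graphs satisfy both, whereas folding an antipodal graph of odd diameter violates this
    one and of even diameter the next. *)
Definition closer_odd (T : finType) (e : rel T) t :=
  forall u x v, gdist e u x = t -> gdist e u v = t -> e x v ->
  exists y, [/\ e x y, e v y & (gdist e u y).+1 = t].

Definition closer_even (T : finType) (e : rel T) t :=
  forall u x y1 y2, gdist e u x = t -> (gdist e u y1).+1 = t -> (gdist e u y2).+1 = t ->
  e x y1 -> e x y2 ->
  [\/ y1 = y2, e y1 y2 | exists z, [/\ e y1 z, e y2 z & (gdist e u z).+2 = t]].

Section Fold.
Variables (T : finType) (e : rel T) (d : nat).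
Hypothesis drg : distance_regular e d.
Hypothesis d6 : 6 <= d.
Hypothesis same_trans : transitive (antip e d).
Notation dist := (gdist e).
Notation nb := (nb e).
Notation same := (antip e d).
Notation fd := (fdist e d).
Local Notation es := (drg_sym drg).
Local Notation ei := (drg_irr drg).
Local Notation ec := (drg_conn drg).
Local Notation dC := (distC es ec).
Local Notation t := d./2.

Let d3 : 3 <= d. Proof. exact: leq_trans d6. Qed.

(** [pick] returns the same vertex for equal predicates, so a fibre has one representative and the
    quotient becomes a subtype of [T]. *)
Definition rep x := odflt x [pick y | same x y].

Lemma rep_same x : same x (rep x).
Proof. by rewrite /rep; case: pickP => //= _; exact: same_refl drg x. Qed.

Lemma same_rep x y : same x y -> rep x = rep y.
Proof.
move=> sxy; rewrite /rep (@eq_pick _ _ (same y)) => [|z].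
  by case: pickP => // /(_ y); rewrite (same_refl drg).
by apply/idP/idP; apply: same_trans; rewrite // (same_sym drg).
Qed.

Lemma rep_idem x : rep (rep x) == rep x.
Proof. by apply/eqP/esym/same_rep/rep_same. Qed.

Definition fold_type : finType := {x : T | rep x == x}.
Definition proj x : fold_type := exist _ (rep x) (rep_idem x).
Definition fold_rel : rel fold_type := fun u v => fd (val u) (val v) == 1.

Lemma proj_val u : proj (val u) = u.
Proof. by apply: val_inj => /=; apply/eqP; exact: valP u. Qed.

Lemma proj_eq x y : (proj x == proj y) = same x y.
Proof.
rewrite -val_eqE /=; apply/eqP/idP => [E|/same_rep//].
apply: same_trans (rep_same x) _; rewrite E (same_sym drg); exact: rep_same.
Qed.

Lemma fd_proj x y : fd (val (proj x)) (val (proj y)) = fd x y.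
Proof.
rewrite -(fd_same drg d3 same_trans _ (rep_same y)) (fd_sym drg).
by rewrite -(fd_same drg d3 same_trans _ (rep_same x)) (fd_sym drg).
Qed.

Lemma fold_relE x y : fold_rel (proj x) (proj y) = (fd x y == 1).
Proof. by rewrite /fold_rel fd_proj. Qed.

Lemma fd_le_dist x y : fd x y <= dist x y. Proof. exact: geq_minl. Qed.

Lemma fd_small x y : 2 * dist x y <= d -> fd x y = dist x y.
Proof. by move=> h; rewrite /fdist; lia. Qed.

Lemma fd_edge x y : e x y -> fd x y = 1.
Proof. by move=> xy; rewrite fd_small (dist1 ei ec xy) //; lia. Qed.

Lemma fold_edge x y : e x y -> fold_rel (proj x) (proj y).
Proof. by move=> xy; rewrite fold_relE fd_edge. Qed.

Lemma fold_sym : symmetric fold_rel.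
Proof. by move=> u v; rewrite /fold_rel (fd_sym drg). Qed.

Lemma fold_irr : irreflexive fold_rel.
Proof. by move=> u; rewrite /fold_rel fd_small (distxx ec). Qed.

Lemma proj_connect (r : rel T) (r' : rel fold_type) :
  (forall x y, r x y -> r' (proj x) (proj y)) ->
  forall x y, connect r x y -> connect r' (proj x) (proj y).
Proof.
move=> rr x y; apply: (@connect_last _ r (fun y => connect r' (proj x) (proj y))).
  exact: connect0.
by move=> a b _ ca /rr ab; apply: connect_trans ca (connect1 ab).
Qed.

Lemma fold_conn : gconnected fold_rel.
Proof.
move=> u v; rewrite -(proj_val u) -(proj_val v).
exact: proj_connect fold_edge _ _ (ec _ _).
Qed.

Lemma fold_lift x y : fd x y = 1 -> exists2 y', same y y' & e x y'.
Proof.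
move=> h; have [y' sy dy] := near drg d3 x y; exists y' => //.
by rewrite -(dist_eq1 ei ec) dy h.
Qed.

Lemma fold_dist u v : gdist fold_rel u v = fd (val u) (val v).
Proof.
apply/eqP; rewrite eqn_leq; apply/andP; split.
  have [y sy dy] := near drg d3 (val u) (val v); rewrite -dy.
  have -> : v = proj y by rewrite -(proj_val v); apply/eqP; rewrite proj_eq.
  rewrite -{1}(proj_val u); move: (val u) => x {u v sy dy}.
  have [n dn] : exists n, dist x y = n by exists (dist x y).
  elim: n y dn => [|n IH] y dn.
    by move/eqP: dn; rewrite (dist_eq0 ec) => /eqP->; rewrite (distxx fold_conn).
  case: (dist_pred ec dn) => z dz zy; rewrite dn.
  apply: leq_trans (dist_edge fold_conn _ (fold_edge zy)) _.
  by rewrite ltnS; have := IH z dz; rewrite dz.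
suff [y sy dy] : exists2 y, same (val v) y & dist (val u) y <= gdist fold_rel u v.
  by rewrite (fd_same drg d3 same_trans _ sy); apply: leq_trans (fd_le_dist _ _) dy.
have [n dn] : exists n, gdist fold_rel u v = n by exists (gdist fold_rel u v).
elim: n v dn => [|n IH] v dn.
  move/eqP: (dn); rewrite (dist_eq0 fold_conn) => /eqP->.
  by exists (val v); [exact: same_refl drg _|rewrite (distxx ec)].
case: (dist_pred fold_conn dn) => z dz /eqP zv; case: (IH z dz) => y sy dy.
have yv : fd y (val v) = 1 by rewrite (fd_sym drg) -(fd_same drg d3 same_trans _ sy) (fd_sym drg).
case: (fold_lift yv) => v' sv' ev; exists v' => //.
by rewrite dn; apply: leq_trans (dist_edge ec _ ev) _; rewrite ltnS -dz.
Qed.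

Lemma fold_dist_proj x y : gdist fold_rel (proj x) (proj y) = fd x y.
Proof. by rewrite fold_dist fd_proj. Qed.

(** Neighbours of [w] correspond to neighbours of a lift [w'], as two of these are at distance at
    most 2 and cannot share a fibre. Taking the lift nearest to [v] makes the distance of [w'] a
    function of the folded one. *)
Lemma fold_nbrs v w j :
  nbrs fold_rel j v w = \sum_(i < d.+1 | minn i (d - i) == j) nb (gdist fold_rel v w) i.
Proof.
have [w' sw dw] := near drg d3 (val v) (val w).
have wE : w = proj w' by rewrite -(proj_val w); apply/eqP; rewrite proj_eq.
have -> : nbrs fold_rel j v w = #|[set u | e w' u & fd (val v) u == j]|.
  rewrite /nbrs -[RHS](@card_in_imset _ _ proj).
    apply: eq_card => u; rewrite !inE; apply/andP/imsetP => [[wu uj]|[u' + ->]]; last first.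
      rewrite inE => /andP[wu uj]; split; first by rewrite wE fold_edge.
      by rewrite -(proj_val v) fold_dist_proj.
    move: wu; rewrite wE -{1}(proj_val u) fold_relE => /eqP /fold_lift[u' su wu].
    have uE : u = proj u' by rewrite -(proj_val u); apply/eqP; rewrite proj_eq.
    exists u' => //; rewrite inE wu /=; move: uj; rewrite uE -{1}(proj_val v) fold_dist_proj.
    by [].
  move=> a b; rewrite !inE => /andP[wa _] /andP[wb _] /eqP; rewrite proj_eq => sab.
  apply: (same_close drg sab).
  have := dist_tri ec a w' b; rewrite (dC a w') (dist1 ei ec wa) (dist1 ei ec wb) => le2.
  exact: leq_ltn_trans le2 d3.
rewrite fold_dist -dw card_sumb.
have E := sum_nbrs drg (fun i => minn i (d - i) == j) (val v) w'.
rewrite [RHS]big_mkcond /=.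
transitivity (\sum_(u | e w' u) (minn (dist (val v) u) (d - dist (val v) u) == j)).
  by rewrite [RHS]big_mkcond; apply: eq_bigr => u _; rewrite -/(fdist e d (val v) u); case: (e w' u).
by rewrite E; apply: eq_bigr => i _; case: ifP; rewrite ?mul1n.
Qed.

Lemma half_le : 2 * t <= d.
Proof. by rewrite mul2n -{2}(odd_double_half d) leq_addl. Qed.

Lemma fold_drg : distance_regular fold_rel t.
Proof.
have h := half_le.
apply: drg_intro; last first.
- by move=> j v w v' w' dE; rewrite !fold_nbrs dE.
- split=> [u v|]; first by rewrite fold_dist; have := fd_le drg d3 (val u) (val v); lia.
  have [|x [y dxy]] := @dist_exists _ _ _ drg t; first by lia.
  by exists (proj x), (proj y); rewrite fold_dist_proj fd_small ?dxy.
- exact: fold_conn.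
by split; [exact: fold_sym|exact: fold_irr].
Qed.

(** As [d./2] is below [d] and the graph is not bipartite, Smith's theorem leaves only connectedness
    upstairs, and paths project. *)
Lemma fold_primitive : 3 <= nb 0 1 -> ~ parity_graph e -> primitive_drg fold_rel t.
Proof.
move=> k3 npg; split; first exact: fold_drg.
move=> i /andP[i0 it]; have h := half_le.
have [|c|[hd _]|[hp _ _]] := @smith _ _ _ drg d3 i k3; first by lia.
- move=> u v; rewrite -(proj_val u) -(proj_val v); apply: proj_connect (c _ _) => x y.
  rewrite /dist_graph => /eqP dxy; rewrite fold_dist_proj fd_small dxy //; lia.
- by lia.
by [].
Qed.

Section FoldAut.
Variable s : {perm T}.
Hypotheses (sA : graph_aut e s) (s1 : s != 1%g).

Definition fold_fun (u : fold_type) : fold_type := proj (s (val u)).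

Lemma fold_fun_inj : injective fold_fun.
Proof.
move=> u v /eqP; rewrite proj_eq (same_aut drg sA) -proj_eq !proj_val; exact: eqP.
Qed.

Definition fold_perm := perm fold_fun_inj.

Lemma fold_perm_aut : graph_aut fold_rel fold_perm.
Proof.
move=> u v; rewrite !permE fold_relE /fold_rel; congr (_ == _).
by rewrite /fdist (aut_dist ec).
Qed.

Lemma fold_perm1 : fold_perm = 1%g -> #|moved s| = #|T|.
Proof.
move=> E; rewrite (moved_all drg d3 sA s1) ?cardsT // => u um.
have : same u (s u).
  have : fold_perm (proj u) = proj u by rewrite E perm1.
  move/eqP; rewrite permE proj_eq => h.
  have su : same (s u) (s (val (proj u))) by rewrite (same_aut drg sA) rep_same.
  by rewrite (same_sym drg); exact: same_trans su h.
by rewrite /antip (dist_eq0 ec) eq_sym (negbTE um) => /eqP->.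
Qed.

Lemma fold_moved : #|moved fold_perm| * fsize e d <= #|moved s|.
Proof.
rewrite -(card_imset _ val_inj); apply: (card_fibres drg d3 same_trans).
  move=> _ _ /imsetP[u _ ->] /imsetP[v _ ->] /same_rep.
  by move/eqP: (valP u) => ->; move/eqP: (valP v) => ->.
move=> _ /imsetP[u + ->]; rewrite inE permE => um; apply/subsetP => y; rewrite !inE => suy.
apply: contra um => /eqP sy; rewrite -{2}(proj_val u) proj_eq.
have : same (s (val u)) (s y) by rewrite (same_aut drg sA).
rewrite sy => h; have suy' : same y (val u) by rewrite (same_sym drg y).
exact: same_trans h suy'.
Qed.

End FoldAut.

Lemma fold_card : #|T| <= #|fold_type| * fsize e d.
Proof.
rewrite -[X in X <= _]muln1 -cardsT -[#|fold_type|]cardsT -(card_imset _ val_inj).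
apply: (@double_count_le _ _ _ (fun x y => same y x)) => [x _|x _]; last first.
  by rewrite -(card_fibre drg d3 x); apply: subset_leq_card; apply/subsetP => y; rewrite !inE.
apply/card_gt0P; exists (rep x); rewrite inE (same_sym drg) rep_same andbT.
by apply/imsetP; exists (proj x).
Qed.

(** Take [u], [v] at distance [t.+1] and [x] just before [v] on a geodesic. A common descent lifts
    to one vertex adjacent to both, and the member of the fibre of [u] near it is [u] itself; so [v]
    would be within [t] of [u]. *)
Lemma fold_odd_closer : d = (2 * t).+1 ->
  ~ closer_odd fold_rel t.
Proof.
move=> dE H; have [|u [v duv]] := @dist_exists _ _ _ drg t.+1; first by lia.
case: (dist_pred ec duv) => x dux xv.
have e1 : gdist fold_rel (proj u) (proj x) = t by rewrite fold_dist_proj fd_small ?dux //; lia.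
have e2 : gdist fold_rel (proj u) (proj v) = t by rewrite fold_dist_proj /fdist duv; lia.
have [y [xy vy uy]] := H _ _ _ e1 e2 (fold_edge xv).
move: xy vy uy; rewrite -(proj_val y) !fold_relE fold_dist_proj; move: (val y) => {y} y.
move=> /eqP /fold_lift[y1 s1 xy1] /eqP /fold_lift[y2 s2 vy2] duy.
have E : y1 = y2.
  have s12 : same y1 y2 by apply: same_trans s2; rewrite (same_sym drg).
  apply: (same_close drg s12).
  have := dist_tri ec y1 x y2; have := dist_tri ec x v y2.
  rewrite (dC y1 x) (dist1 ei ec xy1) (dist1 ei ec xv) (dist1 ei ec vy2) => h1 h2.
  apply: leq_ltn_trans h2 _; apply: leq_ltn_trans (leq_add (leqnn 1) h1) _.
  exact: leq_trans d6.
have [u' su du'] := near drg d3 y1 u.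
have du'' : (dist y1 u').+1 = t.
  by rewrite du' (fd_sym drg) -(fd_same drg d3 same_trans _ s1).
have close z : e z y1 -> dist z u' <= t.
  by move=> zy; have := dist_tri ec z y1 u'; rewrite (dist1 ei ec zy) -du''.
have E2 : u = u'.
  apply: (same_close drg su); have := dist_tri ec u x u'; have := close x xy1.
  rewrite dux; move: dE; clear; lia.
have := close v; rewrite E => /(_ vy2); rewrite -E2 dC duv; lia.
Qed.

(** Take [x] midway between antipodes [u] and [u2], with [y1] and [y2] descending to one each. If
    they are equal or adjacent, [u] and [u2] are too close; a further common descent [z] lifts to
    one vertex near both antipodes, which would then coincide. *)
Lemma fold_even_closer : d = 2 * t ->
  ~ closer_even fold_rel t.
Proof.
move=> dE H; have t3 : 3 <= t by move: dE d6; clear; lia.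
have [|u [x dux]] := @dist_exists _ _ _ drg t; first by rewrite [X in _ <= X]dE leq_pmull.
have [u2 du2] := sphere_nonempty drg u (leqnn d).
have su2 : same u u2 by rewrite /antip du2 eqxx orbT.
have fux : fd u x = t by rewrite fd_small ?dux // -dE.
have du2x : dist u2 x = t.
  have := fd_same drg d3 same_trans x su2; rewrite (fd_sym drg) fux /fdist (dC x).
  have := le_diam drg u2 x; move: dE; clear; lia.
have tS : t = t.-1.+1 by rewrite (ltn_predK t3).
rewrite tS in dux du2x; case: (dist_pred ec dux) => y1 d1 e1; case: (dist_pred ec du2x) => y2 d2 e2.
have f1 : fd u y1 = t.-1 by rewrite fd_small d1 //; move: dE t3; clear; lia.
have f2 : fd u y2 = t.-1.
  rewrite (fd_sym drg) (fd_same drg d3 same_trans _ su2) (fd_sym drg) fd_small d2 //.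
  by move: dE t3; clear; lia.
have d12 : dist y1 y2 <= 2.
  by have := dist_tri ec y1 x y2; rewrite (dist1 ei ec e1) (dC x y2) (dist1 ei ec e2).
have du : dist u u2 <= t.-1 + dist y1 y2 + t.-1.
  apply: leq_trans (dist_tri ec u y2 u2) _; rewrite (dC y2) d2 leq_add2r -d1.
  exact: dist_tri ec u y1 y2.
have e1' : e x y1 by rewrite es.
have e2' : e x y2 by rewrite es.
have Hc := H (proj u) (proj x) (proj y1) (proj y2).
rewrite !fold_dist_proj fux f1 f2 -tS (fold_edge e1') (fold_edge e2') in Hc.
case: (Hc erefl erefl erefl isT isT) => [/eqP|E|[z]].
- rewrite proj_eq => s12; have E : y1 = y2.
    by apply: (same_close drg s12); apply: leq_ltn_trans d12 d3.
  by move: du; rewrite E (distxx ec) du2; move: dE t3; clear; lia.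
- have : dist y1 y2 = 1.
    move: E; rewrite fold_relE fd_small => [/eqP//|].
    by move: d12 dE t3; clear; lia.
  by move=> E1; move: du; rewrite E1 du2; move: dE t3; clear; lia.
rewrite -(proj_val z) !fold_relE fold_dist_proj; move: (val z) => {z} z.
move=> [/eqP /fold_lift[z1 s1 yz1] /eqP /fold_lift[z2 s2 yz2] duz].
have E : z1 = z2.
  have s12 : same z1 z2 by apply: same_trans s2; rewrite (same_sym drg).
  apply: (same_close drg s12).
  have := dist_tri ec z1 y1 z2; have := dist_tri ec y1 y2 z2.
  rewrite (dC z1 y1) (dist1 ei ec yz1) (dist1 ei ec yz2) => h1 h2.
  by move: h1 h2 d12 d6; clear; lia.
have [u' su du'] := near drg d3 z1 u.
have du'' : (dist z1 u').+2 = t.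
  by rewrite du' (fd_sym drg) -(fd_same drg d3 same_trans _ s1).
have E1 : u = u'.
  apply: (same_close drg su); have := dist_tri ec u y1 u'; have := dist_tri ec y1 z1 u'.
  by rewrite d1 (dist1 ei ec yz1); move: du'' dE t3; clear; lia.
have E2 : u2 = u'.
  have su' : same u2 u' by apply: same_trans su; rewrite (same_sym drg).
  apply: (same_close drg su'); have := dist_tri ec u2 y2 u'; have := dist_tri ec y2 z1 u'.
  by rewrite d2 E (dist1 ei ec yz2) -E; move: du'' dE t3; clear; lia.
by move: du2; rewrite E1 E2 (distxx ec); move: d6; clear; lia.
Qed.

End Fold.

(** * Hamming and Johnson graphs *)

Lemma gdist_char (T : finType) (e : rel T) (h : T -> T -> nat) : gconnected e ->
  (forall x, h x x = 0) -> (forall x y, h x y = 0 -> x = y) ->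
  (forall x y z, e y z -> h x z <= (h x y).+1) ->
  (forall x y, 0 < h x y -> exists2 z, e z y & (h x z).+1 = h x y) ->
  forall x y, gdist e x y = h x y.
Proof.
move=> ec h0 h0' h1 h2 x y; apply/eqP; rewrite eqn_leq; apply/andP; split.
  have [n hn] : exists n, h x y = n by exists (h x y).
  elim: n y hn => [|n IH] y hn; first by rewrite (h0' _ _ hn) distxx.
  have [|z zy hz] := h2 x y; first by rewrite hn.
  rewrite hn in hz *; apply: leq_trans (dist_edge ec x zy) _.
  by case: hz => hz; rewrite ltnS; have := IH z hz; rewrite hz.
have [n dn] : exists n, gdist e x y = n by exists (gdist e x y).
elim: n y dn => [|n IH] y dn.
  by move/eqP: dn; rewrite (dist_eq0 ec) => /eqP->; rewrite h0.
case: (dist_pred ec dn) => z dz zy; apply: leq_trans (h1 x z y zy) _.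
by rewrite dn ltnS; have := IH z dz; rewrite dz.
Qed.

Section Hamming.
Variables (T : finType) (e : rel T) (t m : nat) (g : T -> {ffun 'I_t -> 'I_m}).
Hypotheses (ec : gconnected e) (gb : bijective g).
Hypothesis ge : forall x y, hamming_rel (g x) (g y) = e x y.

Definition hdiff (p q : {ffun 'I_t -> 'I_m}) := [set i | p i != q i].

Lemma hdiffC p q : hdiff p q = hdiff q p.
Proof. by apply/setP => i; rewrite !inE eq_sym. Qed.

Lemma g_onto p : exists x, g x = p.
Proof. by case: gb => f _ gK; exists (f p). Qed.

Definition hupd (q : {ffun 'I_t -> 'I_m}) i c := [ffun j => if j == i then c else q j].

Lemma hdiff_upd (q : {ffun 'I_t -> 'I_m}) i c : q i != c -> hdiff q (hupd q i c) = [set i].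
Proof.
move=> qc; apply/setP => j; rewrite !inE ffunE; case: (j =P i) => [->|]; rewrite ?eqxx //.
Qed.

Lemma hdiff_updD (p q : {ffun 'I_t -> 'I_m}) i : hdiff p (hupd q i (p i)) = hdiff p q :\ i.
Proof. by apply/setP => j; rewrite !inE ffunE; case: (j =P i) => [->|] /=; rewrite ?eqxx. Qed.

Lemma hamming_dist x y : gdist e x y = #|hdiff (g x) (g y)|.
Proof.
apply: (gdist_char (h := fun x y => #|hdiff (g x) (g y)|)) => // {x y} [x|x y|x y z|x y].
- by apply/eqP; rewrite cards_eq0; apply/eqP/setP => i; rewrite !inE eqxx.
- move/eqP; rewrite cards_eq0 => /eqP E; apply: (bij_inj gb); apply/ffunP => i.
  by move/setP: E => /(_ i); rewrite !inE => /negbFE/eqP.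
- rewrite -ge => /eqP yz; rewrite -addn1 -yz; apply: leq_trans _ (leq_card_setU _ _).
  apply: subset_leq_card; apply/subsetP => i; rewrite !inE.
  by case: (g x i =P g y i) => [->|].
case/card_gt0P => i ixy; have [z gz] := g_onto (hupd (g y) i (g x i)).
exists z; last by rewrite gz hdiff_updD [in RHS](cardsD1 i) ixy.
rewrite -ge gz /hamming_rel -/(hdiff _ _) hdiffC hdiff_upd ?cards1 //.
by move: ixy; rewrite inE eq_sym.
Qed.

Lemma hdiff_full (p q : {ffun 'I_t -> 'I_m}) : #|hdiff p q| = t -> forall i, p i != q i.
Proof.
move=> E i; have : hdiff p q = setT by apply/eqP; rewrite eqEcard subsetT cardsT card_ord E leqnn.
by move/setP/(_ i); rewrite !inE.
Qed.

Lemma hamming_edge x y : e x y -> exists i, hdiff (g x) (g y) = [set i].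
Proof. by rewrite -ge => /cards1P. Qed.

Lemma edge_of_hdiff x y i : hdiff (g x) (g y) = [set i] -> e x y.
Proof. by rewrite -ge /hamming_rel -/(hdiff _ _) => ->; rewrite cards1. Qed.

(** Both [x] and [v] differ from [u] everywhere; resetting the coordinate in which they differ to
    its value in [u] gives the common descent. *)
Lemma hamming_closer_odd : closer_odd e t.
Proof.
move=> u x v; rewrite !hamming_dist => ux uv xv.
have [i xi] := hamming_edge xv; have [y gy] := g_onto (hupd (g x) i (g u i)).
exists y; rewrite hamming_dist gy; split.
- by apply: (@edge_of_hdiff _ _ i); rewrite gy hdiff_upd // eq_sym hdiff_full.
- have E : hupd (g x) i (g u i) = hupd (g v) i (g u i).
    apply/ffunP => j; rewrite !ffunE; case: (j =P i) => // ji.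
    by move/setP: xi => /(_ j); rewrite !inE => h; apply/eqP; apply/negPn; rewrite h; apply/eqP.
  by apply: (@edge_of_hdiff _ _ i); rewrite gy E hdiff_upd // eq_sym hdiff_full.
by rewrite hdiff_updD -[RHS]ux [in RHS](cardsD1 i) inE hdiff_full.
Qed.

(** A descent from [x] resets one coordinate to its value in [u]; two different descents are
    completed by resetting both. *)
Lemma hamming_closer_even : 3 <= t -> closer_even e t.
Proof.
move=> t3 u x y1 y2; rewrite !hamming_dist => ux uy1 uy2 xy1 xy2.
have upd y : #|hdiff (g u) (g y)|.+1 = t -> e x y -> exists i, g y = hupd (g x) i (g u i).
  move=> uy xy; have [i xi] := hamming_edge xy; exists i.
  have same j : j != i -> g y j = g x j.
    move=> ji; move/setP: xi => /(_ j); rewrite !inE (negbTE ji) => /negbFE/eqP //.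
  have [j uyj] : exists j, g u j = g y j.
    have [j] : exists j, j \notin hdiff (g u) (g y).
      apply/existsP; rewrite -negb_forall; apply/negP => /forallP h.
      have : #|[set: 'I_t]| <= #|hdiff (g u) (g y)| by apply: subset_leq_card; apply/subsetP => j _.
      by rewrite cardsT card_ord -[X in X <= _]uy ltnn.
    by rewrite inE negbK => /eqP; exists j.
  have ji : j = i.
    apply/eqP/negPn/negP => /same E; move: (hdiff_full ux j); by rewrite uyj E eqxx.
  apply/ffunP => l; rewrite ffunE; case: (l =P i) => [->|/eqP/same//].
  by rewrite -ji.
have [i1 E1] := upd y1 uy1 xy1; have [i2 E2] := upd y2 uy2 xy2.
have [i12|i12] := eqVneq i1 i2.
  by constructor 1; apply: (bij_inj gb); rewrite E1 E2 i12.
constructor 3; have [z gz] := g_onto (hupd (g y1) i2 (g u i2)).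
exists z; rewrite hamming_dist gz; split.
- apply: (@edge_of_hdiff _ _ i2); rewrite gz hdiff_upd // E1 ffunE (eq_sym i2) (negbTE i12).
  by rewrite eq_sym hdiff_full.
- apply: (@edge_of_hdiff _ _ i1); rewrite gz.
  have -> : hupd (g y1) i2 (g u i2) = hupd (g y2) i1 (g u i1).
    apply/ffunP => j; rewrite !ffunE E1 E2 !ffunE.
    by case: (j =P i2) => [->|//]; rewrite (eq_sym i2) (negbTE i12).
  by rewrite hdiff_upd // E2 ffunE (negbTE i12) eq_sym hdiff_full.
have i2n : i2 \in hdiff (g u) (g y1) by rewrite E1 inE ffunE (eq_sym i2) (negbTE i12) hdiff_full.
by rewrite hdiff_updD -[RHS]uy1 [in RHS](cardsD1 i2) i2n.
Qed.

End Hamming.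

Section Johnson.
Variables (T : finType) (e : rel T) (t m : nat) (g : T -> johnson_vertex m t).
Hypotheses (ec : gconnected e) (gb : bijective g).
Hypothesis ge : forall x y, johnson_rel (g x) (g y) = e x y.
Hypothesis t3 : 3 <= t.
Notation G x := (val (g x)).

Lemma G_card x : #|G x| = t. Proof. exact/eqP/(valP (g x)). Qed.

Lemma G_onto (A : {set 'I_m}) : #|A| = t -> exists x, G x = A.
Proof.
move=> /eqP cA; case: gb => f _ gK; exists (f (exist _ A cA)).
by rewrite gK.
Qed.

Lemma G_inj x y : G x = G y -> x = y.
Proof. by move/val_inj/(bij_inj gb). Qed.

Lemma johnson_edgeE x y : e x y = (#|G x :\: G y| == 1).
Proof.
rewrite -ge /johnson_rel; have := cardsID (G y) (G x); rewrite G_card => E.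
by apply/eqP/eqP; move: E t3; clear; lia.
Qed.

Lemma cardsD_sym x y : #|G x :\: G y| = #|G y :\: G x|.
Proof.
have := cardsID (G y) (G x); have := cardsID (G x) (G y); rewrite !G_card setIC; lia.
Qed.

Lemma card_swap (A : {set 'I_m}) a b : a \notin A -> b \in A -> #|a |: (A :\ b)| = #|A|.
Proof. by move=> aA bA; rewrite cardsU1 !inE (negbTE aA) andbF [RHS](cardsD1 b) bA. Qed.

Lemma swap_setD (A : {set 'I_m}) a b : a \notin A -> b \in A -> A :\: (a |: (A :\ b)) = [set b].
Proof.
move=> aA bA; have ba : b != a by apply: contraNneq aA => <-.
apply/setP => i; rewrite !inE negb_or negb_and negbK.
case: (i =P b) => [->|_] /=; first by rewrite ba bA.
by case: (i \in A); rewrite ?andbF.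
Qed.

Lemma edge_swap x y a b : a \notin G x -> b \in G x -> G y = a |: (G x :\ b) -> e x y.
Proof. by move=> aA bA Gy; rewrite johnson_edgeE Gy swap_setD // cards1. Qed.

Lemma johnson_dist x y : gdist e x y = #|G x :\: G y|.
Proof.
apply: (gdist_char (h := fun x y => #|G x :\: G y|)) => // {x y} [x|x y|x y z|x y].
- by rewrite setDv cards0.
- move/eqP; rewrite cards_eq0 setD_eq0 => sub; apply: G_inj; apply/eqP.
  by rewrite eqEcard sub !G_card leqnn.
- rewrite johnson_edgeE => /eqP yz; rewrite -addn1 -yz; apply: leq_trans _ (leq_card_setU _ _).
  by apply: subset_leq_card; apply/subsetP => i; rewrite !inE; case: (i \in G y) => /andP[-> ->].
move=> h; have /card_gt0P[b] : 0 < #|G y :\: G x| by rewrite cardsD_sym.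
rewrite inE => /andP[bx yb].
move/card_gt0P: h => [a]; rewrite inE => /andP[ay xa].
have [z Gz] : exists z, G z = a |: (G y :\ b) by apply: G_onto; rewrite card_swap ?G_card.
exists z; first by rewrite johnson_edgeE cardsD_sym Gz swap_setD // cards1.
have aD : a \in G x :\: G y by rewrite inE ay xa.
rewrite Gz [in RHS](cardsD1 a) aD add1n; congr _.+1; apply: eq_card => i.
rewrite !inE; case: (i =P a) => //= _; case: (i =P b) => [->|] //=.
by rewrite (negbTE bx) andbF.
Qed.

Lemma disjoint_of_dist u x : #|G u :\: G x| = t -> forall i, i \in G u -> i \notin G x.
Proof.
move=> E i iu; have : G u :\: G x = G u by apply/eqP; rewrite eqEcard subsetDl G_card E leqnn.
by move/setP/(_ i); rewrite inE iu andbT.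
Qed.

(** The sets of [x] and [v] are disjoint from that of [u] and differ in one element; replacing it by
    an element of [u] gives the same set from both. *)
Lemma johnson_closer_odd : closer_odd e t.
Proof.
move=> u x v; rewrite !johnson_dist => ux uv xv.
have [c uc] : exists c, c \in G u by apply/card_gt0P; rewrite G_card; lia.
have cx := disjoint_of_dist ux uc; have cv := disjoint_of_dist uv uc.
have := xv; rewrite johnson_edgeE => /cards1P[a Ea].
have := xv; rewrite johnson_edgeE cardsD_sym => /cards1P[b Eb].
have xa : (a \in G x) && (a \notin G v).
  by have : a \in G x :\: G v; [rewrite Ea set11|rewrite inE andbC].
have vb : (b \in G v) && (b \notin G x).
  by have : b \in G v :\: G x; [rewrite Eb set11|rewrite inE andbC].
case/andP: xa => xa va; case/andP: vb => vb xb.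
have xvE : G x :\ a = G v :\ b.
  apply/setP => i; move/setP: Ea => /(_ i); move/setP: Eb => /(_ i); rewrite !inE.
  case: (i =P a) => [->|_]; first by rewrite (negbTE va) !andbF.
  case: (i =P b) => [->|_]; first by rewrite (negbTE xb) !andbF.
  by case: (i \in G x); case: (i \in G v).
have [y Gy] : exists y, G y = c |: (G x :\ a) by apply: G_onto; rewrite card_swap ?G_card.
exists y; rewrite johnson_dist; split.
- exact: (edge_swap cx xa Gy).
- by apply: (edge_swap cv vb); rewrite Gy xvE.
rewrite Gy -[RHS](G_card u) [in RHS](cardsD1 c) uc add1n; congr _.+1; apply: eq_card => i.
rewrite !inE negb_or negb_and; case: (i =P c) => //= _.
by case iu: (i \in G u); rewrite ?andbF ?andbT // (disjoint_of_dist ux iu) orbT.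
Qed.

(** A descent replaces an element of [x] by one of [u]. Two descents sharing the removed or the
    inserted element are equal or adjacent; otherwise doing both replacements gives [z]. *)
Lemma johnson_closer_even : closer_even e t.
Proof.
move=> u x y1 y2; rewrite !johnson_dist => ux uy1 uy2 xy1 xy2.
have upd y : #|G u :\: G y|.+1 = t -> e x y -> exists c a,
    [/\ c \in G u, a \in G x & G y = c |: (G x :\ a)].
  move=> uy xy; have := xy; rewrite johnson_edgeE => /cards1P[a Ea].
  have := xy; rewrite johnson_edgeE cardsD_sym => /cards1P[b Eb].
  have xa : a \in G x by have : a \in G x :\: G y; [rewrite Ea set11|rewrite inE => /andP[]].
  have /card_gt0P[c] : 0 < #|G u :&: G y|.
    by have := cardsID (G y) (G u); rewrite G_card; move: uy; clear; lia.
  rewrite inE => /andP[uc yc]; have cx := disjoint_of_dist ux uc.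
  have cb : c = b by apply/set1P; rewrite -Eb inE cx.
  exists c, a; split => //; apply/setP => i.
  move/setP: Ea => /(_ i); move/setP: Eb => /(_ i); rewrite !inE cb.
  case: (i =P b) => [-> <-|_]; first by rewrite -cb cx yc.
  by case: (i =P a) => [->|_]; case: (i \in G x); case: (_ \in G y).
have [c1 [a1 [uc1 xa1 E1]]] := upd y1 uy1 xy1; have [c2 [a2 [uc2 xa2 E2]]] := upd y2 uy2 xy2.
have cx1 := disjoint_of_dist ux uc1; have cx2 := disjoint_of_dist ux uc2.
have ac c a : c \in G u -> a \in G x -> (a == c) = false.
  by move=> uc xa; apply/eqP => E; case/negP: (disjoint_of_dist ux uc); rewrite -E.
have [c12|c12] := eqVneq c1 c2; have [a12|a12] := eqVneq a1 a2.
- by constructor 1; apply: G_inj; rewrite E1 E2 c12 a12.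
- constructor 2; apply: (@edge_swap _ _ a1 a2).
  + by rewrite E1 !inE eqxx /= (ac _ _ uc1 xa1).
  + by rewrite E1 !inE (eq_sym a2 a1) a12 xa2 orbT.
  rewrite E1 E2 -c12; apply/setP => i; rewrite !inE.
  case: (i =P a1) => [->|_] /=; first by rewrite a12 xa1 orbT.
  by case: (i =P a2) => [->|_] //=; rewrite (ac _ _ uc1 xa2).
- constructor 2; apply: (@edge_swap _ _ c2 c1).
  + by rewrite E1 !inE (eq_sym c2 c1) (negbTE c12) (negbTE cx2) andbF.
  + by rewrite E1 !inE eqxx.
  rewrite E1 E2 -a12; apply/setP => i; rewrite !inE.
  case: (i =P c1) => [->|_] //=; by rewrite (negbTE cx1) andbF.
constructor 3.
have y1c2 : c2 \notin G y1 by rewrite E1 !inE (eq_sym c2 c1) (negbTE c12) (negbTE cx2) andbF.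
have y1a2 : a2 \in G y1 by rewrite E1 !inE (eq_sym a2 a1) a12 xa2 orbT.
have [z Gz] : exists z, G z = c2 |: (G y1 :\ a2) by apply: G_onto; rewrite card_swap ?G_card.
exists z; rewrite johnson_dist; split.
- exact: (edge_swap y1c2 y1a2 Gz).
- apply: (@edge_swap _ _ c1 a1).
  + by rewrite E2 !inE (negbTE c12) (negbTE cx1) andbF.
  + by rewrite E2 !inE a12 xa1 orbT.
  rewrite Gz E1 E2; apply/setP => i; rewrite !inE.
  case: (i =P c1) => [->|_] /=; first by rewrite (eq_sym c1 a2) (ac _ _ uc1 xa2) orbT.
  case: (i =P c2) => [->|_] /=; first by rewrite (eq_sym c2 a1) (ac _ _ uc2 xa1).
  by case: (i =P a1) => //=; rewrite ?andbF // => _; case: (i =P a2).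
have c2u : c2 \in G u :\: G y1 by rewrite inE y1c2.
rewrite -[RHS]uy1 [in RHS](cardsD1 c2) c2u add1n; congr _.+2; apply: eq_card => i.
rewrite Gz !inE; case: (i =P c2) => //= _.
case: (i =P a2) => [->|_] //=; rewrite y1a2 /=; apply/negbTE.
by apply: contraL xa2 => /(disjoint_of_dist ux).
Qed.

End Johnson.

(** * Motion *)

Section RatBounds.
Local Open Scope ring_scope.

Lemma ratio_bound (g : rat) (N n m : nat) : g <= N%:R^-1 -> (0 < N)%N -> (n <= N * m)%N ->
  g * n%:R <= m%:R.
Proof.
move=> gN N0 nm; apply: le_trans (ler_wpM2r (ler0n _ n) gN) _.
by rewrite ler_pdivrMl ?ltr0n // -natrM ler_nat.
Qed.

Lemma ratio_bound_trans (g g' : rat) (n n' m m' r : nat) : 0 <= g -> g <= g' ->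
  (n <= n' * r)%N -> (m' * r <= m)%N -> g' * n'%:R <= m'%:R -> g * n%:R <= m%:R.
Proof.
move=> g0 gg nn mm h.
apply: le_trans (_ : g * (n' * r)%:R <= _); first by rewrite ler_wpM2l // ler_nat.
apply: le_trans (_ : g' * (n' * r)%:R <= _); first by rewrite ler_wpM2r // ler0n.
apply: le_trans (_ : (m' * r)%:R <= _); last by rewrite ler_nat.
by rewrite !natrM mulrA ler_wpM2r // ler0n.
Qed.

End RatBounds.

(** The case split is constructive because the permutations of [T] form a finite type. *)
Lemma motion_or_small (T : finType) (e : rel T) (r : rat) :
  motion_at_least e r \/
  exists s : {perm T}, [/\ graph_aut e s, s != 1%g & (#|moved s|%:R < r)%R].
Proof.
have [/existsP[s /and3P[/forallP sA s1 lt]]|none] := boolP [exists s : {perm T},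
    [&& [forall x, forall y, e (s x) (s y) == e x y], s != 1%g & (#|moved s|%:R < r)%R]].
  right; exists s; split=> // x y; exact/eqP/(forallP (sA x)).
left=> s sA s1; rewrite leNgt; apply: contra none => lt.
apply/existsP; exists s; rewrite s1 lt !andbT.
by apply/forallP => x; apply/forallP => y; rewrite sA.
Qed.

Lemma fold_not_classical (T : finType) (e : rel T) d (drg : distance_regular e d) :
  6 <= d -> transitive (antip e d) ->
  ~ ((exists m, is_hamming (@fold_rel T e d) d./2 m) \/ (exists m, is_johnson (@fold_rel T e d) m d./2)).
Proof.
move=> d6 st cl; have t3 : 3 <= d./2 by have := half_leq d6.
have fc := fold_conn drg d6 st.
have [co ce] : closer_odd (@fold_rel T e d) d./2 /\ closer_even (@fold_rel T e d) d./2.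
  case: cl => [[m [g [gb ge]]]|[m [_ [g [gb ge]]]]]; split.
  - exact: hamming_closer_odd fc gb ge.
  - exact: hamming_closer_even fc gb ge t3.
  - exact: johnson_closer_odd fc gb ge t3.
  exact: johnson_closer_even fc gb ge t3.
have := odd_double_half d; rewrite -mul2n; case: (odd d) => dE.
  by apply: fold_odd_closer co => //; rewrite -[LHS]dE.
by apply: fold_even_closer ce => //; rewrite -[LHS]dE.
Qed.

Theorem theorem5 :
  (forall d' : nat, 3 <= d' ->
     exists gamma : rat, (0 < gamma)%R /\
       forall (T : finType) (e : rel T), primitive_drg e d' ->
         motion_at_least e (gamma * #|T|%:R)%R
         \/ (exists s, is_hamming e d' s)
         \/ (exists s, is_johnson e s d')) ->
  forall d : nat, 3 <= d ->
    exists gamma : rat, (0 < gamma)%R /\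
      forall (T : finType) (e : rel T), distance_regular e d ->
        motion_at_least e (gamma * #|T|%:R)%R
        \/ (exists s, is_johnson e s d)
        \/ (exists s, is_hamming e d s)
        \/ is_cocktail_party e.
Proof.
move=> H d d3; have [g1 [g1p H1]] := H d d3.
have [g2 [g2p H2]] : exists g2 : rat, (0 < g2)%R /\ (6 <= d ->
    forall (T : finType) (e : rel T), primitive_drg e d./2 ->
         motion_at_least e (g2 * #|T|%:R)%R
         \/ (exists s, is_hamming e d./2 s)
         \/ (exists s, is_johnson e s d./2)).
  (* Below 6 the number [d./2] is less than 3, and 1 is a default for [g2]. *)
  case: (leqP 6 d) => [d6|_]; last by exists 1%R.
  by have [g2 [? ?]] := H d./2 (half_leq d6); exists g2.
(* The three entries are the bounds for valency at most 2, for bipartite graphs and for antipodal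
   graphs of diameter at most 5. *)
pose N := maxn (d.+1 * 2 ^ d) (maxn (80 * 10 ^ d * d.+1) (2000 * d.+1)).
have N0 : 0 < N by rewrite !leq_max muln_gt0 expn_gt0.
pose g : rat := Num.min g1 (Num.min g2 (N%:R^-1)%R).
have gp : (0 < g)%R by rewrite !lt_min g1p g2p invr_gt0 ltr0n.
have gle1 : (g <= g1)%R by rewrite ge_min lexx.
have gle2 : (g <= g2)%R by rewrite !ge_min lexx orbT.
have gleN : (g <= N%:R^-1)%R by rewrite !ge_min lexx !orbT.
exists g; split=> // T e drg.
have bound n m : n <= N * m -> (g * n%:R <= m%:R :> rat)%R by exact: ratio_bound gleN N0.
have done_all : forall s : {perm T}, #|moved s| = #|T| -> (g * #|T|%:R <= #|moved s|%:R :> rat)%R.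
  by move=> s E; apply: bound; rewrite E leq_pmull.
case: (leqP 3 (nb e 0 1)) => [k3|k2]; last first.
  left=> s sA s1; apply: bound; apply: leq_trans (card_bound drg) _.
  apply: leq_trans (_ : N * 1 <= _); last by rewrite leq_mul2l moved_gt0 ?orbT.
  rewrite muln1 leq_max leq_mul2l leq_exp2r; first by rewrite (ltnSE k2).
  exact: leq_trans d3.
have [mot|[s0 [s0A s01 lt0]]] := motion_or_small e (g * #|T|%:R)%R; first by left.
have lt0N : N * #|moved s0| < #|T|.
  by rewrite ltnNge; apply: contraL lt0 => le; rewrite -leNgt bound.
have [/forallP prim|] := boolP [forall i : 'I_d.+1, (0 < i) ==>
    [forall x, forall y, connect (dist_graph e i) x y]].
  have pr : primitive_drg e d.
    split=> // i /andP[i0 id] x y; have /implyP/(_ i0)/forallP/(_ x)/forallP := prim (Ordinal (id : i < d.+1)).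
    exact.
  case: (H1 T e pr) => [mot|[ham|joh]]; last 2 first.
  - by right; right; left.
  - by right; left.
  left=> s sA s1; apply: le_trans (mot s sA s1).
  by rewrite ler_wpM2r // ler0n.
rewrite negb_forall => /existsP[i]; rewrite negb_imply => /andP[i0 ni].
have id : 1 <= i <= d by rewrite i0 -ltnS ltn_ord.
have bip : parity_graph e -> is_cocktail_party e.
  move=> pg; have [le|//] := bipartite_motion drg d3 pg k3 s0A s01.
  move: lt0N; rewrite ltnNge (leq_trans le) // leq_mul2r.
  by rewrite (leq_trans (leq_maxl _ _) (leq_maxr _ _)) orbT.
have [c|[iE RE]|[pg _ _]] := smith drg d3 k3 id; last by right; right; right; exact: bip.
  by case/negP: ni; apply/forallP => x; apply/forallP => y; exact: c.
have st : transitive (antip e d).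
  by move=> y x z; rewrite /antip -!RE; exact: connect_trans.
(* An antipodal graph can also be bipartite; it then falls under the bipartite case. *)
have [pg|npg] := boolP [forall w, forall x, forall y, e x y ==>
    (odd (gdist e w y) == ~~ odd (gdist e w x))].
  right; right; right; apply: bip => w x y xy.
  by move/forallP/(_ w)/forallP/(_ x)/forallP/(_ y)/implyP/(_ xy)/eqP: pg.
have {}npg : ~ parity_graph e.
  move=> pg; case/negP: npg; apply/forallP => w; apply/forallP => x; apply/forallP => y.
  by apply/implyP => xy; apply/eqP; exact: pg.
have [d6|d5] := leqP 6 d; last first.
  exfalso; have d35 : 3 <= d <= 5 by rewrite d3 -ltnS.
  have := antipodal_small_motion drg d35 npg st k3 s0A s01.
  rewrite leqNgt => /negP; apply; apply: leq_ltn_trans lt0N; rewrite leq_mul2r.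
  by rewrite (leq_trans (leq_maxr _ _) (leq_maxr _ _)) orbT.
case: (H2 d6 _ _ (fold_primitive drg d6 st k3 npg)) => [mot|cl]; last first.
  by case: (fold_not_classical drg d6 st cl).
left=> s sA s1.
(* An automorphism that preserves every fibre moves all vertices, so the folded graph is consulted
   only for a nontrivial induced automorphism. *)
have [E|f1] := eqVneq (fold_perm drg st sA) 1%g.
  exact: done_all _ (fold_perm1 d6 s1 E).
have := mot _ (fold_perm_aut drg d6 st sA) f1.
exact: ratio_bound_trans (ltW gp) gle2 (fold_card drg d6 st) (fold_moved drg d6 st sA).
Qed.
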